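(* Let $d>2$, let $T_d$ be the $d$-regular tree, let $A$ be a finite nonempty set, and let $(\psi_v)_{v\in V(T_d)}$ be a local symmetric (i.e. $\operatorname{Aut}(T_d)$-invariant) potential such that there is a unique Gibbs measure $\nu$ for it. Then for any symmetric real observable $(\alpha_v)_{v\in V(T_d)}$ there is a constant $C$ such that for any two vertices $u,v\in V(T_d)$, $$\operatorname{Cov}_\nu(\alpha_u,\alpha_v)\le C\,(d-1)^{-k/4},$$ where $k$ is the graph distance between $u$ and $v$.
   Context: $V(T_d)$ is the vertex set of $T_d$, $\operatorname{Aut}(T_d)$ its automorphism group, and $\operatorname{Ball}(v,R)$ the ball of radius $R$ around $v$ in the graph distance. For $W\subset V(T_d)$, $\operatorname{pr}_W:A^{V(T_d)}\to A^W$ is the natural projection. $\operatorname{Aut}(T_d)$ acts on $A^{V(T_d)}$ by $(\gamma\omega)(v)=\omega(\gamma^{-1}v)$. A potential is a collection $(\psi_v)_{v\in V(T_d)}$ of functions $\psi_v:A^{V(T_d)}\to\mathbb{R}$. It is local if for every $v$ there are a positive integer $D$ and a function $\psi'_v:A^{\operatorname{Ball}(v,D)}\to\mathbb{R}$ with $\psi_v=\psi'_v\circ\operatorname{pr}_{\operatorname{Ball}(v,D)}$. It is symmetric if $\psi_{\gamma v}(\gamma\omega)=\psi_v(\omega)$ for all $v\in V(T_d)$, $\gamma\in\operatorname{Aut}(T_d)$, $\omega\in A^{V(T_d)}$. For a local symmetric potential there is a positive integer $R$ such that every $\psi_v$ depends only on the restriction to $\operatorname{Ball}(v,R)$; fix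 such an $R$, so $\psi_v$ may be evaluated on elements of $A^W$ for any $W\supset \operatorname{Ball}(v,R)$. A symmetric real observable is a collection $(\alpha_v)_{v\in V(T_d)}$ of functions $\alpha_v:A^{V(T_d)}\to\mathbb{R}$ satisfying the same two requirements (local and symmetric); in particular it takes only finitely many values. $\operatorname{Cov}_\nu(\alpha_u,\alpha_v)=\mathbb{E}_\nu(\alpha_u\alpha_v)-\mathbb{E}_\nu(\alpha_u)\,\mathbb{E}_\nu(\alpha_v)$. For $W\subset V(T_d)$ and a positive integer $r$, $\partial^r W$ is the set of vertices outside $W$ at distance at most $r$ from $W$. For $s\in A^{\Lambda_1}$, $t\in A^{\Lambda_2}$ with $\Lambda_1\cap\Lambda_2=\varnothing$, $s\sqcup t\in A^{\Lambda_1\cup\Lambda_2}$ is their gluing. A Borel probability measure $\mu$ on $A^{V(T_d)}$ is a Gibbs measure for $(\psi_v)$ if for every finite $\Lambda\subset V(T_d)$, every $s\in A^\Lambda$ and $t\in A^{\partial^{2R}\Lambda}$ (with conditioning event of positive probability), $$\Pr\big(\operatorname{pr}_\Lambda(\omega)=s\,\big|\,\operatorname{pr}_{\partial^{2R}\Lambda}(\omega)=t\big)=\frac{\exp\big(-\sum_{v\in\Lambda\cup\partial^R\Lambda}\psi_v(s\sqcup t)\big)}{\sum_{s'\in A^\Lambda}\exp\big(-\sum_{v\in\Lambda\cup\partial^R\Lambda}\psi_v(s'\sqcup t)\big)},$$ where $\omega$ is distributed according to $\mu$. *)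

(* Defs.v *)
From HB Require Import structures.
From mathcomp Require Import all_boot all_order all_algebra finmap.
From mathcomp Require Import all_classical all_reals all_analysis.

Set Implicit Arguments.
Unset Strict Implicit.
Unset Printing Implicit Defensive.

Import Order.TTheory GRing.Theory Num.Theory.

Local Open Scope classical_set_scope.
Local Open Scope ring_scope.

Section Graphs.
Variables (V : choiceType) (E : rel V).

Definition walk (n : nat) (x y : V) : Prop :=
  exists p : seq V, [/\ path E x p, last x p = y & size p = n].

(* Simple cycles are the duplicate-free cyclic sequences of length at least 3:
   a [ucycle] of length 2 only goes back and forth along one edge. *)
Record regular_tree (d : nat) : Prop := RegularTree {
  rt_nonempty : [set: V] !=set0;
  rt_sym : symmetric E;
  rt_irr : irreflexive E;
  rt_connected : forall x y, exists n, walk n x y;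
  rt_acyclic : forall c : seq V, ucycle E c -> (size c <= 2)%N;
  rt_regular : forall x, ([set y | E x y] #= `I_d)%card
}.

(* The length of a shortest walk; the default 0 is only used for vertices in
   different components, hence never in a tree. *)
Definition gdist (x y : V) : nat :=
  if pselect (exists n, `[< walk n x y >]) is left h then ex_minn h else 0%N.

Definition gball (x : V) (n : nat) : set V := [set y | (gdist x y <= n)%N].

Definition gboundary (n : nat) (W : set V) : set V :=
  [set y | ~ W y /\ exists2 x, W x & (gdist x y <= n)%N].

Record graph_aut : Type := GraphAut {
  aut_fun :> V -> V;
  aut_inv : V -> V;
  aut_funK : cancel aut_fun aut_inv;
  aut_invK : cancel aut_inv aut_fun;
  aut_edge : forall x y, E (aut_fun x) (aut_fun y) = E x y
}.

End Graphs.

(* The letter [a0] only records that [A] is nonempty: measurable types are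
   pointed. *)
Definition config (V : choiceType) (A : finType) (a0 : A) : Type := V -> A.

HB.instance Definition _ (V : choiceType) (A : finType) (a0 : A) :=
  Choice.on (config V a0).
HB.instance Definition _ (V : choiceType) (A : finType) (a0 : A) :=
  isPointed.Build (config V a0) (fun=> a0).

Definition open_config (V : choiceType) (A : finType) (a0 : A) :
    set (set (config V a0)) :=
  @open (prod_topology (fun _ : V => discrete_topology A)).

Definition borel_config (V : choiceType) (A : finType) (a0 : A) :=
  g_sigma_algebraType (@open_config V A a0).

Section Configurations.
Variables (V : choiceType) (A : finType).

(* The projection A^V -> A^W. *)
Definition pr (W : set V) (w : V -> A) : W -> A := fun x => w (val x).

(* For disjoint S and W, [gluing s t] extends the gluing of s and of the
   restriction of t to W; a function factoring through the projection to a
   subset of their union takes the same value for all such extensions. *)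
Definition gluing (S : {fset V}) (s : {ffun S -> A}) (t : V -> A) : V -> A :=
  fun v => if insub v is Some x then s x else t v.

Definition cylinder (S : {fset V}) (s : {ffun S -> A}) : set (V -> A) :=
  [set w | forall x : S, w (val x) = s x].

Definition factors_through (R : Type) (W : set V) (f : (V -> A) -> R) : Prop :=
  exists f' : (W -> A) -> R, forall w, f w = f' (pr w).

Variable (E : rel V).

Definition local (R : Type) (psi : V -> (V -> A) -> R) : Prop :=
  forall v, exists2 D : nat, (0 < D)%N & factors_through (gball E v D) (psi v).

Definition has_range (R : Type) (r : nat) (psi : V -> (V -> A) -> R) : Prop :=
  forall v, factors_through (gball E v r) (psi v).

Definition act (g : graph_aut E) (w : V -> A) : V -> A :=
  fun v => w (aut_inv g v).

Definition symmetric_family (R : Type) (psi : V -> (V -> A) -> R) : Prop :=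
  forall (g : graph_aut E) (v : V) (w : V -> A), psi (g v) (act g w) = psi v w.

End Configurations.

Section Gibbs.
Variables (R : realType) (V : choiceType) (E : rel V) (A : finType) (a0 : A).

(* A finitely supported sum is 0 by convention when the support is infinite;
   here the index set is finite because the tree is locally finite. *)
Definition boltzmann (psi : V -> (V -> A) -> R) (r : nat) (S : {fset V})
    (s : {ffun S -> A}) (t : V -> A) : R :=
  expR (- \sum_(v \in [set` S] `|` gboundary E r [set` S]) psi v (gluing s t)).

Definition cond_prob (mu : probability (borel_config V a0) R)
    (B C : set (borel_config V a0)) : R :=
  fine (mu (B `&` C)) / fine (mu C).

(* The boundary condition in A^(gboundary E (2 * r) S) is the restriction of
   the configuration t; by finite range, both sides depend on t only through
   that restriction. *)
Definition gibbs (psi : V -> (V -> A) -> R) (r : nat)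
    (mu : probability (borel_config V a0) R) : Prop :=
  forall (S : {fset V}) (s : {ffun S -> A}) (t : V -> A),
    let bdry : set (V -> A) :=
      [set w | pr w = pr t :> (gboundary E (2 * r) [set` S] -> A)] in
    (0 < mu bdry)%E ->
    cond_prob mu (cylinder s) bdry =
      boltzmann psi r s t / \sum_(s' : {ffun S -> A}) boltzmann psi r s' t.

(* Measures are functions on all sets, so they are compared on measurable
   sets only. *)
Definition unique_gibbs (psi : V -> (V -> A) -> R) (r : nat)
    (nu : probability (borel_config V a0) R) : Prop :=
  gibbs psi r nu /\
  forall mu : probability (borel_config V a0) R, gibbs psi r mu ->
    forall B, measurable B -> mu B = nu B.

Definition Cov (nu : probability (borel_config V a0) R)
    (f g : (V -> A) -> R) : \bar R :=
  ('E_nu[(fun w => f w * g w)%R] - 'E_nu[f] * 'E_nu[g])%E.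

End Gibbs.

(* Main.v *)
Require Import Defs.
From HB Require Import structures.
From mathcomp Require Import all_boot all_order all_algebra finmap.
From mathcomp Require Import zify ring lra.
From mathcomp Require Import all_classical all_reals all_analysis.
From mathcomp Require Import measurable_realfun.

(** Let b = d - 1 and, for a symmetric local family F, let A F be the family of
    averages of F over the neighbours of a vertex.

    The Gibbs measure, being the only one, is invariant under automorphisms
    ([expect_act]), and automorphisms move any pair of vertices to any other pair
    at the same distance ([two_point_homogeneous]).  Hence A is self-adjoint for
    the covariance at a root o, and p |-> Cov (F_o, (p(A) F)_o) is a positive
    functional L on polynomials in one variable ([cov_moment_positive]).  The same
    averaging operator acts on finitely supported functions on the tree; there
    p |-> (p(A) delta_o)(o) is a positive functional T, for which A has norm at
    most 2 sqrt b / d ([tree_sqnormX_le]).  Both give a seminorm on polynomials,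
    the square root of p |-> L (p^2), respectively of p |-> T (p^2).

    Uniqueness is used through [decorrelation]: an observable at o is nearly
    uncorrelated with functions of finitely many spins far away from o.  If it
    were not, tilting the measure by such functions of ever more distant spins and
    taking a limit along an ultrafilter would give a second Gibbs measure; the
    tilted measures are at most twice the original one, so that the limit is
    countably additive.  In p(A) F = sum_j kappa_j(p) S_j F, where S_j F is the sum
    of F over the sphere of radius j, the terms with small j are controlled by the
    T-norm of p and the others are functions of distant spins.  So for every e > 0
    there is K with L p <= e (1 + L (p^2)) + K T (p^2) ([sphere_decoupling]).

    This inequality forces the L-norm of A to be at most its T-norm
    ([spectral_transfer]).  The polynomial q = 1 - (1 - A^2k)^M takes values
    in [0, 1], is close to 1 where |A| is larger than the T-norm of A and is close
    to 0 elsewhere.  Its T-norm is small, hence L q is small; as q is nearly a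
    projection, L has no mass where q is close to 1.

    Finally S_k F = P_k(A) F with P_(k+1) = d A P_k - b P_(k-1).  A quadratic
    energy of this recurrence is multiplied by b at each step, and the norm bound
    on A turns it into L (P_k^2)^(1/2) <= K (k + 1) b^(k/2) ([spherical_growth]).
    Since Cov (F_u, F_v) is the covariance of F_o with S_k F_o divided by the size
    of the sphere, which is at least b^k, it is at most C (k + 1) b^(-k/2)
    ([cov_sqrt_decay]), and (k + 1) b^(-k/4) is bounded. *)

Set Implicit Arguments.
Unset Strict Implicit.
Unset Printing Implicit Defensive.

Import Order.TTheory GRing.Theory Num.Theory.
Local Open Scope classical_set_scope.
Local Open Scope ring_scope.

(** * Positive functionals on polynomials *)

(** A positive semidefinite binary quadratic form has nonpositive discriminant;
    this is the Cauchy-Schwarz inequality of both bilinear forms used below. *)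
Lemma discriminant_le (R : realFieldType) (a b c : R) :
  (forall s t, 0 <= s ^+ 2 * a + 2 * s * t * c + t ^+ 2 * b) -> c ^+ 2 <= a * b.
Proof.
move=> H.
have a0 : 0 <= a by have := H 1 0; rewrite expr1n expr0n /= !mulr0 !mul0r !addr0 mul1r.
have b0 : 0 <= b by have := H 0 1; rewrite expr1n expr0n /= !mulr0 !mul0r !add0r mul1r.
have [a00|an0] := eqVneq a 0; last first.
  have ap : 0 < a by rewrite lt_neqAle eq_sym an0.
  have := H c (- a).
  have -> : c ^+ 2 * a + 2 * c * (- a) * c + (- a) ^+ 2 * b = a * (a * b - c ^+ 2) by ring.
  by rewrite pmulr_rge0// subr_ge0.
have [->|cn0] := eqVneq c 0; first by rewrite expr0n /= mulr_ge0.
have := H (- (b + 1) / (2 * c)) 1; rewrite a00.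
have -> : (- (b + 1) / (2 * c)) ^+ 2 * 0 + 2 * (- (b + 1) / (2 * c)) * 1 * c + 1 ^+ 2 * b = -1.
  by field.
by rewrite lerNr oppr0 ler10.
Qed.

Lemma ler_of_sqr (R : realDomainType) (a b : R) :
  0 <= b -> a ^+ 2 <= b ^+ 2 -> a <= b.
Proof.
move=> b0; case: (lerP a 0) => [a0 _|a0]; first exact: le_trans b0.
by rewrite ler_pXn2r// nnegrE// ltW.
Qed.

Section MomentFunctional.
Variable R : realFieldType.
Implicit Types (x y : nat -> R) (p q : {poly R}).

(** The linear functional on polynomials whose value at the i-th power of the
    variable is the i-th term of the sequence. *)
Definition moments x p : R := \sum_(i < size p) p`_i * x i.

Lemma moments_wide x p n : (size p <= n)%N ->
  moments x p = \sum_(i < n) p`_i * x i.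
Proof.
move=> pn; rewrite /moments (big_ord_widen n (fun i => p`_i * x i)) // big_mkcond /=.
by apply: eq_bigr => i _; case: ltnP => // /(nth_default 0) ->; rewrite mul0r.
Qed.

Lemma momentsD x p q : moments x (p + q) = moments x p + moments x q.
Proof.
pose n := maxn (size p) (size q).
rewrite (@moments_wide _ p n) ?leq_maxl// (@moments_wide _ q n) ?leq_maxr//.
rewrite (@moments_wide _ (p + q) n) ?size_polyD// -big_split /=.
by apply: eq_bigr => i _; rewrite coefD mulrDl.
Qed.

Lemma momentsZ x c p : moments x (c *: p) = c * moments x p.
Proof.
rewrite (@moments_wide _ (c *: p) (size p)) ?size_scale_leq// mulr_sumr.
by apply: eq_bigr => i _; rewrite coefZ mulrA.
Qed.

Lemma momentsN x p : moments x (- p) = - moments x p.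
Proof. by rewrite -scaleN1r momentsZ mulN1r. Qed.

Lemma momentsB x p q : moments x (p - q) = moments x p - moments x q.
Proof. by rewrite momentsD momentsN. Qed.

Lemma moments0 x : moments x 0 = 0.
Proof. by rewrite -(scale0r 0) momentsZ mul0r. Qed.

Lemma moments1 x : moments x 1 = x 0.
Proof. by rewrite (@moments_wide _ 1 1) ?size_poly1// big_ord1 coef1 mul1r. Qed.

Lemma momentsX x p : moments x ('X * p) = moments (fun i => x i.+1) p.
Proof.
rewrite (@moments_wide _ _ (size p).+1); last by apply: leq_trans (size_polyMleq _ _) _; rewrite size_polyX.
rewrite big_ord_recl coefXM /= mul0r add0r.
by apply: eq_bigr => i _; rewrite coefXM.
Qed.

Lemma moments_comb x y c e p :
  moments (fun i => c * x i + e * y i) p = c * moments x p + e * moments y p.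
Proof.
rewrite /moments !mulr_sumr -big_split /=.
by apply: eq_bigr => i _; ring.
Qed.

Lemma eq_moments x y p : x =1 y -> moments x p = moments y p.
Proof. by move=> e; apply: eq_bigr => i _; rewrite e. Qed.

Definition sqnorm x p := moments x (p ^+ 2).

Definition positive_moments x := forall p, 0 <= sqnorm x p.

Lemma sqnormZ x c p : sqnorm x (c *: p) = c ^+ 2 * sqnorm x p.
Proof. by rewrite /sqnorm exprZn momentsZ. Qed.

Lemma sqnormN x p : sqnorm x (- p) = sqnorm x p.
Proof. by rewrite /sqnorm sqrrN. Qed.

Section Positive.
Variable x : nat -> R.
Hypothesis pos : positive_moments x.
Local Notation L := (moments x).
Local Notation N := (sqnorm x).

Lemma sqnormDE p q : N (p + q) = N p + 2 * L (p * q) + N q.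
Proof. by rewrite /sqnorm sqrrD mulr2n !momentsD; ring. Qed.

Lemma moments_CS p q : L (p * q) ^+ 2 <= N p * N q.
Proof.
apply: discriminant_le => s t.
have := pos (s *: p + t *: q).
by rewrite sqnormDE !sqnormZ -scalerAl -scalerAr !momentsZ; lra.
Qed.

Lemma sqnormD_le p q : N (p + q) <= 2 * N p + 2 * N q.
Proof.
have := pos (p - q); rewrite sqnormDE sqnormDE sqnormN mulrN momentsN.
lra.
Qed.

Lemma sqnormB_le p q : N (p - q) <= 2 * N p + 2 * N q.
Proof. by have := sqnormD_le p (- q); rewrite sqnormN. Qed.

Lemma sqnorm_sum_le (f : nat -> {poly R}) n c :
  (forall i, N (f i) <= c) -> N (\sum_(i < n) f i) <= n%:R ^+ 2 * c.
Proof.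
move=> fc; have c0 : 0 <= c by apply: le_trans (fc 0%N).
elim: n => [|n IH]; first by rewrite big_ord0 /sqnorm expr0n moments0 mulr_ge0 ?sqr_ge0.
rewrite big_ord_recr /= sqnormDE.
set S := \sum_(i < n) f i in IH *.
have /le_trans/(_ (ler_pM (pos _) (pos _) IH (fc n))) := moments_CS S (f n).
have -> : n%:R ^+ 2 * c * c = (n%:R * c) ^+ 2 by ring.
have nc : 0 <= n%:R * c by rewrite mulr_ge0.
move/(ler_of_sqr nc) => H.
have := fc n; rewrite -natr1; move: IH H; set a := n%:R; nra.
Qed.

End Positive.

End MomentFunctional.

(** * Comparing the norms of two positive functionals *)

Section Contraction.
Variables (R : realFieldType) (x : nat -> R) (r : R).
Hypothesis pos : positive_moments x.
Hypotheses (r0 : 0 <= r) (r1 : r <= 1).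
Hypothesis contr : forall p, sqnorm x ('X * p) <= r * sqnorm x p.
Local Notation L := (moments x).
Local Notation N := (sqnorm x).

Lemma sqnormXn_le k p : N ('X^k * p) <= r ^+ k * N p.
Proof.
elim: k => [|k IH]; first by rewrite !expr0 !mul1r.
rewrite exprS -mulrA (le_trans (contr _))// exprS -mulrA.
exact: ler_wpM2l.
Qed.

Lemma sqnormXn_le1 k p : N ('X^k * p) <= N p.
Proof.
apply: (le_trans (sqnormXn_le _ _)).
by rewrite ler_piMl ?exprn_ile1// pos.
Qed.

Variable k : nat.
Let B : {poly R} := 'X^k * 'X^k.

(** Expand the square: the cross term is 2 N (X^k p), and the last term
    N (X^2k p) is at most N (X^k p) because X is a contraction. *)
Lemma landweber_step p : N ((1 - B) * p) <= N p - N ('X^k * p).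
Proof.
have -> : N ((1 - B) * p) = N p - 2 * N ('X^k * p) + N ('X^k * ('X^k * p)).
  rewrite /sqnorm.
  have -> : ((1 - B) * p) ^+ 2
      = p ^+ 2 - ('X^k * p) ^+ 2 - ('X^k * p) ^+ 2 + ('X^k * ('X^k * p)) ^+ 2.
    by rewrite /B; ring.
  by rewrite momentsD !momentsB; ring.
have := sqnormXn_le1 k ('X^k * p); lra.
Qed.

Lemma landweber_contraction i p : N ((1 - B) ^+ i * p) <= N p.
Proof.
elim: i => [|i IH]; first by rewrite expr0 mul1r.
rewrite exprS -mulrA (le_trans (landweber_step _))//.
by rewrite (le_trans _ IH)// gerBl pos.
Qed.

(** The terms N (X^k (1 - B)^i) do not increase with i and, by [landweber_step],
    they add up to at most N 1. *)
Lemma landweber_residual i :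
  i%:R * N ('X^k * (1 - B) ^+ i) + N ((1 - B) ^+ i) <= N 1.
Proof.
elim: i => [|i IH]; first by rewrite expr0 mul0r add0r.
have := landweber_step ((1 - B) ^+ i); rewrite -exprS => H1.
have := landweber_step ('X^k * (1 - B) ^+ i).
have -> : (1 - B) * ('X^k * (1 - B) ^+ i) = 'X^k * (1 - B) ^+ i.+1 by rewrite exprS; ring.
have := pos ('X^k * ('X^k * (1 - B) ^+ i)) => H2 H3.
have i0 : 0 <= i%:R :> R by [].
have H4 : i.+1%:R * N ('X^k * (1 - B) ^+ i.+1) <= i.+1%:R * N ('X^k * (1 - B) ^+ i).
  by apply: ler_wpM2l => //; lra.
by move: H4; rewrite -natr1 !mulrDl !mul1r; lra.
Qed.

(** 1 - (1 - B)^M is the geometric sum of the M terms (1 - B)^i B, and each of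
    them has at most the norm of B. *)
Lemma landweber_sum_le M : N (1 - (1 - B) ^+ M) <= M%:R ^+ 2 * (r ^+ k) ^+ 2 * N 1.
Proof.
have -> : 1 - (1 - B) ^+ M = \sum_(i < M) (1 - B) ^+ i * B.
  rewrite -mulr_suml -opprB subrX1 -mulNr mulrC; congr (_ * _).
  by rewrite opprB opprB addrCA subrr addr0.
rewrite -mulrA; apply: (sqnorm_sum_le pos (f := fun i => (1 - B) ^+ i * B)) => i.
apply: (le_trans (landweber_contraction _ _)).
rewrite /B (le_trans (sqnormXn_le _ _))// expr2 -mulrA ler_wpM2l ?exprn_ge0//.
by have := sqnormXn_le k 1; rewrite mulr1.
Qed.

(** Log-convexity of i |-> N (X^i p): the ratio of consecutive terms does not
    decrease, so it stays above its initial value. *)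
Lemma sqnorm_geometric_growth (s : R) p : 0 < s -> s * N p <= N ('X * p) ->
  s ^+ k * N p <= N ('X^k * p).
Proof.
move=> s0 H.
suff H2 : forall i : nat, s * sqnorm x ('X^i * p : {poly R}) <= N ('X^(i.+1) * p).
  elim: (k) => [|i IH]; first by rewrite !expr0 !mul1r.
  by rewrite (le_trans _ (H2 i))// exprS -mulrA ler_wpM2l// ltW.
elim=> [|i IH]; first by rewrite expr0 mul1r expr1.
have := moments_CS pos ('X^i * p) ('X^(i.+2) * p).
have -> : 'X^i * p * ('X^(i.+2) * p) = ('X^(i.+1) * p) ^+ 2 by rewrite !exprS; ring.
rewrite -/(N _) => H3.
have := pos ('X^(i.+1) * p); have := pos ('X^(i.+2) * p).
rewrite -!/(N _); move: IH H3; rewrite -!/(N _).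
set a := N ('X^i * p); set c := N ('X^(i.+1) * p); set b := N ('X^(i.+2) * p).
move=> IH H3 b0 c0.
have [->|cn0] := eqVneq c 0; first by rewrite mulr0.
have cp : 0 < c by rewrite lt_neqAle eq_sym cn0.
rewrite -(ler_pM2l cp) mulrCA -expr2.
apply: le_trans (_ : s * (a * b) <= _); first by rewrite ler_wpM2l// ltW.
by rewrite mulrA ler_wpM2r.
Qed.

End Contraction.

Lemma geometric_small (R : realType) (q e : R) :
  0 <= q -> q < 1 -> 0 < e -> exists k, q ^+ k <= e.
Proof.
move=> q0 q1 e0.
have q1' : `|q| < 1 by rewrite ger0_norm.
have /cvgrPdist_lt/(_ e e0)[k _ /(_ k (leqnn k))] := cvg_expr q1'.
rewrite /= sub0r normrN ger0_norm ?exprn_ge0// => /ltW ?.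
by exists k.
Qed.

Section SpectralTransfer.
Variables (R : realType) (x t : nat -> R) (r : R).
Hypotheses (xpos : positive_moments x) (tpos : positive_moments t).
Hypotheses (r0 : 0 <= r) (r1 : r < 1).
Hypothesis x_contr : forall p, sqnorm x ('X * p) <= sqnorm x p.
Hypothesis t_contr : forall p, sqnorm t ('X * p) <= r * sqnorm t p.
Hypothesis decoupling : forall e, 0 < e -> exists2 K, 0 <= K & forall p,
  moments x p <= e * (1 + sqnorm x p) + K * sqnorm t p.
Local Notation L := (moments x).
Local Notation N := (sqnorm x).

Let x_contr1 p : N ('X * p) <= 1 * N p. Proof. by rewrite mul1r. Qed.

(** M is about 5 s^(-k), so that K M^2 r^(2k) is of the order of (r / s)^(2k),
    which tends to 0 with k. *)
Lemma landweber_choice s K e : 0 < s -> r < s -> s <= 1 -> 0 <= K -> 0 < e ->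
  exists k M, 5 <= M%:R * s ^+ k /\ K * (M%:R ^+ 2 * (r ^+ k) ^+ 2) <= e.
Proof.
move=> s0 rs s1 K0 e0.
have qs : 0 <= r / s by rewrite divr_ge0// ltW.
have q1 : r / s < 1 by rewrite ltr_pdivrMr// mul1r.
pose c := K * 36 + 1.
have c0 : 0 < c by rewrite /c; lra.
have [k H2] := geometric_small qs q1 (divr_gt0 e0 c0).
have sk : 0 < s ^+ k by rewrite exprn_gt0.
have sk1 : s ^+ k <= 1 by rewrite exprn_ile1// ltW.
have a0 : 0 <= 5 / s ^+ k by rewrite divr_ge0// ltW.
exists k, (Num.truncn (5 / s ^+ k)).+1.
set M := (Num.truncn _).+1.
split.
  by rewrite -ler_pdivrMr// ltW// truncnS_gt.
have M6 : M%:R * s ^+ k <= 6.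
  have : M%:R <= 5 / s ^+ k + 1 by rewrite /M -natr1 lerD2r truncn_le.
  move/(ler_wpM2r (ltW sk)); rewrite mulrDl mul1r divfK ?gt_eqF//; lra.
have -> : K * (M%:R ^+ 2 * (r ^+ k) ^+ 2) = K * ((M%:R * s ^+ k) ^+ 2 * ((r / s) ^+ k) ^+ 2).
  rewrite expr_div_n; field; by rewrite gt_eqF.
have M0 : 0 <= M%:R * s ^+ k by rewrite mulr_ge0// ltW.
have M36 : (M%:R * s ^+ k) ^+ 2 <= 36 by have := ler_pM M0 M0 M6 M6; lra.
have qk0 : 0 <= (r / s) ^+ k by rewrite exprn_ge0.
have qk : ((r / s) ^+ k) ^+ 2 <= e / c.
  apply: le_trans H2; rewrite expr2 ler_piMl// exprn_ile1// ltW//.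
apply: (@le_trans _ _ (c * (e / c))); last by rewrite mulrCA divff ?mulr1// gt_eqF.
rewrite mulrA; apply: ler_pM => //; first by rewrite mulr_ge0// sqr_ge0.
  exact: sqr_ge0.
rewrite /c; apply: (@le_trans _ _ (K * 36)); last by lra.
exact: ler_wpM2l.
Qed.

(** If N X > r N 1, take s with r < s < N X / N 1, and y = (1 - X^2k)^M with the
    exponents of [landweber_choice].  Then q = 1 - y is small for the form of t, hence
    N q <= 2 L q is small by the decoupling hypothesis.  But N (X y) < s N y <= s N 1,
    because growth at rate s would contradict [landweber_residual], and y close to 1
    makes N (X y) close to N X. *)
Theorem spectral_transfer : N 'X <= r * N 1.
Proof.
have N0 := xpos 1.
have NX1 : N 'X <= N 1 by have := x_contr 1; rewrite mulr1.
rewrite leNgt; apply/negP => lt_rX.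
have N1 : 0 < N 1.
  rewrite lt_neqAle eq_sym N0 andbT; apply/negP => /eqP N10.
  by move: lt_rX NX1; rewrite N10 mulr0 => H1 H2; have := lt_le_trans H1 H2; rewrite ltxx.
pose s := (r + N 'X / N 1) / 2.
have rX : r < N 'X / N 1 by rewrite ltr_pdivlMr.
have X1 : N 'X / N 1 <= 1 by rewrite ler_pdivrMr// mul1r.
have rs : r < s by rewrite /s; lra.
have s1 : s <= 1 by rewrite /s; lra.
have s0 : 0 < s by exact: le_lt_trans r0 rs.
have sX : s * N 1 < N 'X by rewrite -ltr_pdivlMr// /s; lra.
pose gap := N 'X - s * N 1.
have gap0 : 0 < gap by rewrite /gap; lra.
(* eta bounds N q; it has to be small against N 1 and against gap^2. *)
pose eta := Num.min (gap ^+ 2 / (16 * N 1)) (N 1 / 10).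
have eta0 : 0 < eta by rewrite lt_min !divr_gt0// ?exprn_gt0//; lra.
have eta1 : 16 * N 1 * eta <= gap ^+ 2.
  by rewrite mulrC -ler_pdivlMr ?ge_min ?lexx//; lra.
have eta2 : eta <= N 1 / 10 by rewrite ge_min lexx orbT.
pose e := eta / (4 * (1 + 4 * N 1)).
have d0 : 0 < 4 * (1 + 4 * N 1) by lra.
have e0 : 0 < e by rewrite divr_gt0.
have [K K0 dec] := decoupling e0.
have [k [M [M5 KM]]] := landweber_choice s0 rs s1
  (mulr_ge0 K0 (tpos 1)) (divr_gt0 eta0 (ltr0n _ 4)).
set B : {poly R} := 'X^k * 'X^k.
pose y := (1 - B) ^+ M; pose q := 1 - y.
have Ny : N y <= N 1.
  by have := landweber_contraction xpos ler01 (lexx 1) x_contr1 k M 1; rewrite mulr1.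
have Nq4 : N q <= 4 * N 1 by have := sqnormB_le xpos 1 y; rewrite -/q; lra.
(* From N y <= N 1, by expanding N (1 - q). *)
have NqL : N q <= 2 * L q.
  have := sqnormDE x 1 (- q).
  have -> : 1 - q = y by rewrite /q opprB addrC subrK.
  rewrite sqnormN mul1r momentsN; lra.
have tq : sqnorm t q <= M%:R ^+ 2 * (r ^+ k) ^+ 2 * sqnorm t 1.
  exact: landweber_sum_le tpos r0 (ltW r1) t_contr k M.
have Nq : N q <= eta.
  have H1 := dec q.
  have H2 : K * sqnorm t q <= eta / 4.
    apply: le_trans KM; apply: le_trans (ler_wpM2l K0 tq) _.
    by rewrite le_eqVlt; apply/orP; left; apply/eqP; ring.
  have H3 : e * (1 + N q) <= eta / 4.
    apply: (@le_trans _ _ (e * (1 + 4 * N 1))); first by apply: ler_wpM2l; [exact: ltW|rewrite lerD2l].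
    rewrite /e le_eqVlt; apply/orP; left; apply/eqP; field.
    by apply/eqP; lra.
  lra.
have Xy : N ('X * y) < s * N y.
  rewrite ltNge; apply/negP => /(sqnorm_geometric_growth xpos k s0) H1.
  have := landweber_residual xpos ler01 (lexx 1) x_contr1 k M; rewrite -/B -/y => H2.
  have N1yq : N 1 <= 2 * N y + 2 * N q.
    by have := sqnormD_le xpos y q; rewrite addrC subrK.
  have Ny0 := xpos y.
  have H3 : 5 * N y <= M%:R * N ('X^k * y).
    apply: (@le_trans _ _ (M%:R * (s ^+ k * N y))); last by rewrite ler_wpM2l.
    by rewrite mulrA ler_wpM2r.
  lra.
(* 1 - y^2 = q (1 + y), so that N X - N (X y) has the factor q. *)
have gapE : gap <= L (q * ('X * ('X * (1 + y)))).
  have -> : L (q * ('X * ('X * (1 + y)))) = N 'X - N ('X * y).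
    by rewrite /sqnorm -momentsB /q; congr (moments _ _); ring.
  rewrite /gap lerB//; apply: (le_trans (ltW Xy)).
  by rewrite ler_wpM2l// ltW.
have H4 : gap ^+ 2 <= eta * (4 * N 1).
  apply: (@le_trans _ _ (L (q * ('X * ('X * (1 + y)))) ^+ 2)).
    by rewrite ler_pXn2r// nnegrE ltW// (lt_le_trans gap0).
  apply: (le_trans (moments_CS xpos _ _)).
  apply: ler_pM => //.
  apply: (le_trans (x_contr _)); apply: (le_trans (x_contr _)).
  by have := sqnormD_le xpos 1 y; lra.
have : 0 < N 1 * eta by rewrite mulr_gt0.
lra.
Qed.

End SpectralTransfer.

(** * The radial functions of the tree *)

Section RadialSequences.
Variables (R : realFieldType) (b : R).
Hypothesis b2 : 2 <= b.
Local Notation D := (b + 1).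
Implicit Types (a c : nat -> R) (p q : {poly R}).

Fact b_gt0 : 0 < b. Proof. by apply: lt_le_trans b2. Qed.
Fact d_gt0 : 0 < D. Proof. by rewrite addr_gt0// b_gt0. Qed.
Fact d_neq0 : D != 0. Proof. by rewrite gt_eqF// d_gt0. Qed.

(** The number of vertices at distance j from the root of the tree of degree
    b + 1. *)
Definition radial_weight j : R := if j is i.+1 then D * b ^+ i else 1.

(** The average over neighbours, in terms of the coefficients a j of the sums over
    spheres of radius j: if f = sum_j a j S_j, where S_j is the sum over spheres of
    radius j, then the average of f is sum_j (radial_step a j) S_j. *)
Definition radial_step a j : R :=
  if j is i.+1 then D^-1 * a i + b / D * a j.+1 else a 1%N.

(** The probability that i steps of the simple random walk from the root end at a
    given vertex at distance j. *)
Definition radial_walk i : nat -> R :=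
  iter i radial_step (fun j => (j == 0%N)%:R).

(** The coefficient of the sphere of radius j in p applied to the averaging
    operator. *)
Definition radial_coef p j : R := moments (fun i => radial_walk i j) p.

(** The inner product of square summable functions on the tree, restricted to the
    radial functions supported in the ball of radius n - 1. *)
Definition radial_form n a c : R := \sum_(j < n) radial_weight j * (a j * c j).

(** The return probabilities of the simple random walk. *)
Definition tree_moment i : R := radial_walk i 0%N.

Lemma radial_weight_ge1 j : 1 <= radial_weight j.
Proof.
have b2' := b2; have b0 := b_gt0.
case: j => [|j] //=.
have : 1 <= b ^+ j by apply: exprn_ege1; lra.
have : 0 <= b * b ^+ j by rewrite mulr_ge0 ?exprn_ge0 ?ltW.
rewrite mulrDl; lra.
Qed.

Lemma radial_coefX p j : radial_coef ('X * p) j = radial_step (radial_coef p) j.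
Proof.
rewrite /radial_coef momentsX.
by case: j => [|j] //=; rewrite -moments_comb; apply: eq_moments.
Qed.

Lemma radial_walk_support i j : (i < j)%N -> radial_walk i j = 0.
Proof.
elim: i j => [|i IH] [|j] //= ij.
have := IH j ij; have := IH j.+2 (leqW (leqW ij)); rewrite /radial_walk => -> ->.
by rewrite !mulr0 addr0.
Qed.

Lemma radial_coef_support p j : (size p <= j)%N -> radial_coef p j = 0.
Proof.
move=> pj; rewrite /radial_coef /moments big1// => i _.
by rewrite radial_walk_support ?mulr0// (leq_trans (ltn_ord i)).
Qed.

(** The averaging operator is self-adjoint up to a boundary term at radius n. *)
Lemma radial_step_form n a c :
  radial_form n.+1 (radial_step a) c - radial_form n.+1 a (radial_step c)
  = b ^+ n * (a n.+1 * c n - a n * c n.+1).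
Proof.
elim: n => [|n IH]; first by rewrite /radial_form !big_ord1 /= expr0; ring.
rewrite /radial_form big_ord_recr /= [X in _ - X]big_ord_recr /=.
rewrite opprD addrACA IH exprS; field.
exact: d_neq0.
Qed.

(** Self-adjointness moves the factor p from one side to the other; taking n
    large kills the boundary term of [radial_step_form]. *)
Lemma tree_moment_form p q : exists n0, forall n, (n0 <= n)%N ->
  moments tree_moment (p * q) = radial_form n (radial_coef p) (radial_coef q).
Proof.
elim/poly_ind: p q => [|p c IH] q.
  exists 0%N => n _; rewrite mul0r moments0 /radial_form big1// => j _.
  by rewrite /radial_coef moments0 mul0r mulr0.
have [n1 H1] := IH ('X * q).
exists (maxn n1 (maxn (size p) (size q))).+1 => -[//|n].
rewrite ltnS !geq_max => /and3P[n1n pn qn].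
have -> : (p * 'X + c%:P) * q = p * ('X * q) + c *: q.
  by rewrite mulrDl mul_polyC mulrA.
rewrite momentsD momentsZ (H1 n.+1) ?leqW//.
have -> : radial_form n.+1 (radial_coef p) (radial_coef ('X * q))
    = radial_form n.+1 (radial_step (radial_coef p)) (radial_coef q).
  apply/esym/eqP; rewrite -subr_eq0; apply/eqP.
  rewrite -[RHS](mulr0 (b ^+ n)).
  have <- : radial_coef p n.+1 * radial_coef q n - radial_coef p n * radial_coef q n.+1 = 0.
    by rewrite !(radial_coef_support (leqW _))// mul0r mulr0 subrr.
  rewrite -radial_step_form; congr (_ - _).
  by apply: eq_bigr => j _; rewrite radial_coefX.
have -> : moments tree_moment q = radial_form n.+1 (fun j => (j == 0%N)%:R) (radial_coef q).
  by rewrite /radial_form big_ord_recl big1 ?addr0 /= ?mul1r// => j _; rewrite mul0r mulr0.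
rewrite /radial_form mulr_sumr -big_split /=; apply: eq_bigr => j _.
have -> : radial_coef (p * 'X + c%:P) j
    = radial_step (radial_coef p) j + c * ((j : nat) == 0%N)%:R.
  by rewrite -radial_coefX /radial_coef momentsD -alg_polyC momentsZ moments1 mulrC.
ring.
Qed.

Lemma tree_sqnormE p : exists n0, forall n, (n0 <= n)%N ->
  sqnorm tree_moment p = radial_form n (radial_coef p) (radial_coef p).
Proof. exact: tree_moment_form. Qed.

Lemma radial_coef_le p j : radial_coef p j ^+ 2 <= sqnorm tree_moment p.
Proof.
have [n0 H] := tree_sqnormE p.
rewrite (H (maxn n0 j.+1)) ?leq_maxl// /radial_form.
have jn : (j < maxn n0 j.+1)%N by rewrite leq_maxr.
rewrite (bigD1 (Ordinal jn)) //= -expr2.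
apply: (@le_trans _ _ (radial_weight j * radial_coef p j ^+ 2)).
  by rewrite ler_peMl ?sqr_ge0// radial_weight_ge1.
rewrite lerDl sumr_ge0// => i _; rewrite mulr_ge0 -?expr2 ?sqr_ge0//.
by apply: le_trans (radial_weight_ge1 _).
Qed.

Lemma tree_moment_positive : positive_moments tree_moment.
Proof. by move=> p; apply: le_trans (radial_coef_le p 0); rewrite sqr_ge0. Qed.

(** The multiple of (a n)^2 that is still available for the contribution of
    radius n + 1 in the induction of [radial_step_le]. *)
Let slack n : R := if n is 0 then 4 * b else 2 * b * radial_weight n.

(** A weighted Schur test: (x + b y)^2 <= 2 x^2 + 2 b^2 y^2, and the weights
    of neighbouring spheres differ by a factor b, except at the root. *)
Lemma radial_step_le n a :
  D ^+ 2 * radial_form n.+1 (radial_step a) (radial_step a) <=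
  4 * b * radial_form n.+2 a a - slack n * a n ^+ 2
  - 2 * b * radial_weight n.+1 * a n.+1 ^+ 2.
Proof.
have b2' := b2; have b0 := b_gt0; have D0 := d_gt0; have Dn0 := d_neq0.
elim: n => [|n IH].
  rewrite /radial_form big_ord1 !big_ord_recr big_ord0 /= expr0.
  have : 0 <= (b - 1) * (b + 1) * a 1%N ^+ 2.
    by rewrite mulr_ge0 ?sqr_ge0// mulr_ge0//; lra.
  lra.
rewrite /radial_form big_ord_recr [X in _ <= _ * X - _ - _]big_ord_recr /=.
rewrite -!/(radial_form _ _ _) [D ^+ 2 * (_ + _)]mulrDr [4 * b * (_ + _)]mulrDr.
have wS : 2 * radial_weight n.+1 * a n ^+ 2 <= slack n * a n ^+ 2.
  rewrite ler_wpM2r ?sqr_ge0//.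
  by case: (n) => [|m] /=; rewrite ?expr0 ?exprS; lra.
have bn : 0 <= b ^+ n by rewrite exprn_ge0 ?ltW.
set u := D^-1 * a n + b / D * a n.+2.
have Eu : D ^+ 2 * (D * b ^+ n * (u * u)) = D * b ^+ n * (a n + b * a n.+2) ^+ 2.
  by rewrite /u; field.
have sq : D * b ^+ n * (a n + b * a n.+2) ^+ 2 <= D * b ^+ n * (2 * a n ^+ 2 + 2 * b ^+ 2 * a n.+2 ^+ 2).
  apply: ler_wpM2l; first by rewrite mulr_ge0// ltW.
  by have := sqr_ge0 (a n - b * a n.+2); lra.
move: IH wS sq Eu => /=; rewrite [b ^+ n.+1]exprS; move: u => u; lra.
Qed.

(** The spectral radius of the simple random walk on the tree is at most
    2 sqrt b / (b + 1). *)
Lemma tree_sqnormX_le p :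
  sqnorm tree_moment ('X * p) <= 4 * b / D ^+ 2 * sqnorm tree_moment p.
Proof.
have b2' := b2; have b0 := b_gt0; have D0 := d_gt0; have Dn0 := d_neq0.
have [n1 H1] := tree_sqnormE p; have [n2 H2] := tree_sqnormE ('X * p).
pose n := maxn n1 n2.
rewrite (H1 n.+2) ?(H2 n.+1) ?leqW ?leq_maxl ?leq_maxr//.
rewrite mulrAC ler_pdivlMr ?exprn_gt0// mulrC.
have -> : radial_form n.+1 (radial_coef ('X * p)) (radial_coef ('X * p))
  = radial_form n.+1 (radial_step (radial_coef p)) (radial_step (radial_coef p)).
  by apply: eq_bigr => j _; rewrite radial_coefX.
apply: (le_trans (radial_step_le _ _)).
have w0 m : 0 <= radial_weight m by apply: le_trans (radial_weight_ge1 m).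
have sl : 0 <= slack n by rewrite /slack; case: (n) => [|m]; do ?apply: mulr_ge0 => //; by [exact: ltW | exact: w0].
have s1 := mulr_ge0 sl (sqr_ge0 (radial_coef p n)).
have s2 : 0 <= 2 * b * radial_weight n.+1 * radial_coef p n.+1 ^+ 2.
  by rewrite mulr_ge0 ?sqr_ge0// mulr_ge0// mulr_ge0// ltW.
lra.
Qed.

End RadialSequences.

(** * Growth of the spherical polynomials *)

Section SphericalPolynomials.
Variables (R : realType) (b : R) (x : nat -> R).
Hypothesis b2 : 2 <= b.
Hypothesis pos : positive_moments x.
Local Notation D := (b + 1).
Local Notation L := (moments x).
Local Notation N := (sqnorm x).
Hypothesis tempered : forall p, N ('X * p) <= 4 * b / D ^+ 2 * N p.

(** The polynomial P_k such that P_k of the averaging operator is the sum over the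
    sphere of radius k.  The coefficient D in degree 2 is exceptional: a vertex has
    b + 1 neighbours through which a walk of length 2 returns to it. *)
Fixpoint spherical k : {poly R} :=
  if k is m.+1 then
    if m is n.+1 then
      D *: ('X * spherical m) - (if n is 0 then D else b) *: spherical n
    else D *: 'X
  else 1.
Local Notation P := spherical.

(** The quadratic form that is conserved, up to a factor b, by the recurrence
    P_(k+1) = D X P_k - b P_(k-1). *)
Let energy k := N (P k.+1) + b * N (P k) - D * L ('X * P k.+1 * P k).


Lemma spherical_energy k : energy k.+1 = b ^+ k * energy 1.
Proof.
elim: k => [|k IH]; first by rewrite expr0 mul1r.
rewrite exprS -mulrA -IH /energy.
have -> : P k.+3 = D *: ('X * P k.+2) - b *: P k.+1 by [].
move: (P k.+2) (P k.+1) => p q.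
have mZ c u : c * L u = L (c *: u) by rewrite momentsZ.
rewrite /sqnorm !mZ -!momentsD -!momentsB mZ; congr (moments _ _).
rewrite -!mul_polyC; ring.
Qed.

(** By Cauchy-Schwarz and the norm bound on X, the cross term of the energy is at
    most 2 sqrt b times the product of the two norms, which completes the square. *)
Lemma sqrt_sqnorm_step k :
  (Num.sqrt (N (P k.+1)) - Num.sqrt b * Num.sqrt (N (P k))) ^+ 2 <= energy k.
Proof.
have b2' := b2; have b0 := b_gt0 b2; have D0 := d_gt0 b2.
set m := Num.sqrt (N (P k.+1)); set n := Num.sqrt (N (P k)).
have Em : m ^+ 2 = N (P k.+1) by rewrite sqr_sqrtr.
have En : n ^+ 2 = N (P k) by rewrite sqr_sqrtr.
have Eb : Num.sqrt b ^+ 2 = b by rewrite sqr_sqrtr// ltW.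
have cross : D * L ('X * P k.+1 * P k) <= 2 * Num.sqrt b * n * m.
  apply: ler_of_sqr; first by rewrite !mulr_ge0 ?sqrtr_ge0.
  rewrite exprMn.
  have -> : 'X * P k.+1 * P k = ('X * P k) * P k.+1 by ring.
  have := moments_CS pos ('X * P k) (P k.+1).
  have := tempered (P k).
  rewrite -Em -En mulrAC ler_pdivlMr ?exprn_gt0// => H1 H2.
  have H3 : D ^+ 2 * L ('X * P k * P k.+1) ^+ 2 <= D ^+ 2 * (N ('X * P k) * m ^+ 2).
    by apply: ler_wpM2l => //; rewrite sqr_ge0.
  have H4 : N ('X * P k) * D ^+ 2 * m ^+ 2 <= 4 * b * n ^+ 2 * m ^+ 2.
    by apply: ler_wpM2r => //; rewrite sqr_ge0.
  have -> : (2 * Num.sqrt b * n * m) ^+ 2 = 4 * b * n ^+ 2 * m ^+ 2 by rewrite -{2}Eb; ring.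
  lra.
have -> : (m - Num.sqrt b * n) ^+ 2
    = m ^+ 2 + Num.sqrt b ^+ 2 * n ^+ 2 - 2 * Num.sqrt b * n * m by ring.
rewrite Em En Eb /energy; lra.
Qed.

(** The norms n_k satisfy n_(k+1) <= sqrt b n_k + sqrt b^(k-1) s, where s^2 is the
    energy at 1: the linear factor k + 1 is the number of summands. *)
Theorem spherical_growth : exists2 K, 0 <= K &
  forall k, Num.sqrt (N (P k)) <= K * k.+1%:R * Num.sqrt b ^+ k.
Proof.
have b2' := b2; have b0 := b_gt0 b2; have D0 := d_gt0 b2.
pose n k := Num.sqrt (N (P k)).
pose c := Num.sqrt b; pose s := Num.sqrt (energy 1).
have c1 : 1 <= c by rewrite -(sqrtr1 R) ler_wsqrtr//; lra.
have c0 : 0 <= c by lra.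
have s0 : 0 <= s by rewrite sqrtr_ge0.
have n0 k : 0 <= n k by rewrite sqrtr_ge0.
have E0 : 0 <= energy 1 by apply: le_trans (sqrt_sqnorm_step 1); rewrite sqr_ge0.
have step k : n k.+2 <= c * n k.+1 + c ^+ k * s.
  rewrite -lerBlDl; apply: ler_of_sqr; first by rewrite mulr_ge0 ?exprn_ge0.
  apply: (le_trans (sqrt_sqnorm_step _)); rewrite spherical_energy exprMn.
  by rewrite sqr_sqrtr// -exprM mulnC exprM sqr_sqrtr// ltW.
pose K := n 0%N + n 1%N + s.
have K0 : 0 <= K by rewrite !addr_ge0.
exists K => //; rewrite -/c.
have main k : n k.+1 <= K * k.+2%:R * c ^+ k.+1.
  elim: k => [|k IH].
    rewrite expr1.
    apply: (@le_trans _ _ (K * 2%:R)); first by have := n0 0%N; have := n0 1%N; rewrite /K; lra.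
    by rewrite ler_peMr ?mulr_ge0.
  apply: (le_trans (step k)).
  have H1 : c * n k.+1 <= K * k.+2%:R * c ^+ k.+2.
    by rewrite [c ^+ _]exprS mulrCA ler_wpM2l.
  have H2 : c ^+ k * s <= K * c ^+ k.+2.
    rewrite mulrC ler_pM ?exprn_ge0 ?ler_weXn2l//.
    by rewrite /K lerDr addr_ge0.
    exact: leqW (leqnSn k).
  have -> : K * k.+3%:R * c ^+ k.+2 = K * k.+2%:R * c ^+ k.+2 + K * c ^+ k.+2 by ring.
  exact: lerD.
case=> [|k]; last exact: main.
by rewrite expr0 !mulr1 /K -/(n 0%N) -addrA lerDl addr_ge0.
Qed.

End SphericalPolynomials.

(** * Regular trees and their automorphisms *)

Section Tree.
Variables (V : choiceType) (E : rel V) (d : nat).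
Hypothesis hT : regular_tree E d.
Local Notation dist := (gdist E).
Local Open Scope nat_scope.

Let Esym : symmetric E := rt_sym hT.

Lemma gdist_walk x y : walk E (dist x y) x y.
Proof.
rewrite /gdist; case: pselect => [h|]; first by case: ex_minnP => n /asboolP.
by have [n w] := rt_connected hT x y; case; exists n; apply/asboolP.
Qed.

Lemma gdist_le n x y : walk E n x y -> dist x y <= n.
Proof.
move=> w; rewrite /gdist; case: pselect => [h|//].
by case: ex_minnP => m _; apply; apply/asboolP.
Qed.

Lemma gdistxx x : dist x x = 0.
Proof. by apply/eqP; rewrite -leqn0; apply: gdist_le; exists [::]. Qed.

Lemma gdist_eq0 x y : (dist x y == 0) = (x == y).
Proof.
apply/eqP/eqP => [H|->]; last exact: gdistxx.
by have [p [_ lp]] := gdist_walk x y; rewrite H => /size0nil p0; rewrite -lp p0.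
Qed.

Lemma walk_sym n x y : walk E n x y -> walk E n y x.
Proof.
move=> [p [pp <- sp]]; exists (rev (belast x p)); split.
- by rewrite rev_path (eq_path (e' := E))// => a b; rewrite Esym.
- by case: (p) => //= a q; rewrite rev_cons last_rcons.
- by rewrite size_rev size_belast.
Qed.

Lemma gdist_sym x y : dist x y = dist y x.
Proof. by apply/eqP; rewrite eqn_leq !gdist_le//; apply: walk_sym; apply: gdist_walk. Qed.

Lemma gdist_triangle y x z : dist x z <= dist x y + dist y z.
Proof.
have [p [pp lp <-]] := gdist_walk x y; have [q [pq lq <-]] := gdist_walk y z.
apply: gdist_le; exists (p ++ q); split.
- by rewrite cat_path pp lp pq.
- by rewrite last_cat lp.
- by rewrite size_cat.
Qed.

Lemma gdist_edge x y : E x y -> dist x y = 1.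
Proof.
move=> xy; apply/eqP; rewrite eqn_leq; apply/andP; split.
  by apply: gdist_le; exists [:: y]; rewrite /= xy.
rewrite lt0n gdist_eq0; apply: contraTneq xy => ->.
by rewrite (rt_irr hT).
Qed.

Lemma edge_gdist x y : dist x y = 1 -> E x y.
Proof.
move=> H; have := gdist_walk x y; rewrite H => -[[|a [|c q]] []] //=.
by rewrite andbT => xa <- _.
Qed.

Lemma gdist_edge_le o x y : E x y -> dist o y <= (dist o x).+1.
Proof. by move=> /gdist_edge xy; rewrite (leq_trans (gdist_triangle x _ _))// xy addn1. Qed.

Lemma gdist_pred o x n : dist o x = n.+1 -> exists2 y, E x y & dist o y = n.
Proof.
move=> H; have := gdist_walk x o; rewrite gdist_sym H => -[[|y p] []] //=.
move=> /andP[xy pp] lp [sp].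
exists y => //; apply/eqP; rewrite eqn_leq; apply/andP; split.
  by rewrite gdist_sym; apply: gdist_le; exists p.
by have := @gdist_edge_le o y x; rewrite Esym xy H => /(_ isT).
Qed.

Lemma descending_path o n y : dist o y = n ->
  exists p, [/\ path E y p, last y p = o & all (fun z => dist o z < n) p].
Proof.
elim: n y => [|n IH] y H.
  by exists [::]; split=> //=; apply/eqP; rewrite eq_sym -gdist_eq0 H.
have [z yz oz] := gdist_pred H; have [p [pp lp ap]] := IH z oz.
exists (z :: p); split=> //=; first by rewrite yz.
by rewrite oz ltnS leqnn /=; apply: sub_all ap => w; apply: leqW.
Qed.

Lemma ascending_path o n z : dist o z = n ->
  exists p, [/\ path E o p, last o p = z & all (fun w => (w == z) || (dist o w < n)) (o :: p)].
Proof.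
elim: n z => [|n IH] z H.
  have -> : z = o by apply/eqP; rewrite eq_sym -gdist_eq0 H.
  by exists [::]; rewrite /= eqxx.
have [y zy oy] := gdist_pred H; have [p [pp lp ap]] := IH y oy.
exists (rcons p z); split.
- by rewrite rcons_path pp lp Esym.
- by rewrite last_rcons.
- rewrite -rcons_cons all_rcons eqxx /=.
  apply: sub_all ap => w /orP[/eqP ->|/leqW ->]; last by rewrite orbT.
  by rewrite oy ltnS leqnn orbT.
Qed.

(** Two such neighbours y and z would be joined through o by a walk that avoids x:
    every vertex of a geodesic from o to y, other than y, is strictly closer to o than
    y.  A simple path extracted from that walk closes to a cycle through x. *)
Lemma closer_neighbor_unique o x y z : E x y -> E x z ->
  dist o y <= dist o x -> dist o z <= dist o x -> y = z.
Proof.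
move=> xy xz oy oz; apply/eqP; apply: contraT => yz.
have nxy : x != y by apply: contraTneq xy => ->; rewrite (rt_irr hT).
have nxz : x != z by apply: contraTneq xz => ->; rewrite (rt_irr hT).
have [p [pp lp ap]] := descending_path (erefl (dist o y)).
have [q [pq lq aq]] := ascending_path (erefl (dist o z)).
have xp : x \notin p.
  by apply/negP => /(allP ap); rewrite ltnNge oy.
have xq : x \notin q.
  apply/negP => xq; have := allP aq x; rewrite inE xq orbT => /(_ isT).
  by rewrite (negbTE nxz) /= ltnNge oz.
have pc : path E y (p ++ q) by rewrite cat_path pp lp pq.
have lc : last y (p ++ q) = z by rewrite last_cat lp lq.
have xc : x \notin y :: p ++ q by rewrite inE negb_or nxy mem_cat negb_or xp xq.
move: lc xc; case/shortenP: pc => p' pp' up' sub lc xc.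
have xp' : x \notin y :: p'.
  by apply: contra xc; rewrite !inE => /orP[->//|/sub ->]; rewrite orbT.
have : ucycle E (x :: y :: p').
  apply/andP; split; last by rewrite cons_uniq xp' up'.
  by rewrite /= xy rcons_path pp' lc Esym xz.
move/(rt_acyclic hT); case: p' lc {pp' up' sub xp'} => //= yzE.
by rewrite yzE eqxx in yz.
Qed.

Lemma neighbor_gdist o x y : E x y ->
  dist o y = (dist o x).+1 \/ dist o x = (dist o y).+1.
Proof.
move=> xy; have H1 := gdist_edge_le o xy.
have H2 : dist o x <= (dist o y).+1 by apply: gdist_edge_le; rewrite Esym.
have [H|] := eqVneq (dist o y) (dist o x); last by lia.
case Ex : (dist o x) => [|n].
  have oxE : o = x by apply/eqP; rewrite -gdist_eq0 Ex.
  have oyE : o = y by apply/eqP; rewrite -gdist_eq0 H Ex.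
  by move: xy; rewrite -oxE -oyE (rt_irr hT).
have [z xz oz] := gdist_pred Ex.
have := @closer_neighbor_unique o x y z xy xz.
by rewrite H oz Ex leqnn leqnSn => /(_ isT isT) yz; move: H; rewrite yz oz Ex; lia.
Qed.

Definition nbrs x : seq V := enum_fset (fset_set [set y | E x y]).

Let finite_nbrs x : finite_set [set y | E x y].
Proof. by apply/finite_setP; exists d; apply: rt_regular. Qed.

Lemma mem_nbrs x y : (y \in nbrs x) = E x y.
Proof.
rewrite -topredE /= [LHS]in_fset_set; last exact: finite_nbrs.
by apply/idP/idP; rewrite inE.
Qed.

Lemma uniq_nbrs x : uniq (nbrs x). Proof. exact: fset_uniq. Qed.

Lemma size_nbrs x : size (nbrs x) = d.
Proof. exact: card_fset_set (rt_regular hT x). Qed.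

Lemma count_nbrs_gdist o x k :
  count (fun y => dist o y == k) (nbrs x) =
  if dist o x is n.+1 then (k == n) + (k == n.+2) * d.-1 else (k == 1) * d.
Proof.
case Ex: (dist o x) => [|n].
  have -> : o = x by apply/eqP; rewrite -gdist_eq0 Ex.
  rewrite (@eq_in_count _ _ (fun=> k == 1)).
    by case: (k == 1); rewrite ?count_predT ?size_nbrs ?mul1n ?count_pred0 ?mul0n.
  by move=> y; rewrite mem_nbrs => /gdist_edge ->; rewrite eq_sym.
have [z xz oz] := gdist_pred Ex.
have zn : z \in nbrs x by rewrite mem_nbrs.
rewrite (permP (perm_to_rem zn)) /= oz eq_sym; congr addn.
rewrite (@eq_in_count _ _ (fun=> k == n.+2)).
  have := size_rem zn; rewrite size_nbrs => <-.
  by case: (k == n.+2); rewrite ?count_predT ?mul1n ?count_pred0 ?mul0n.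
move=> y; rewrite mem_rem_uniq ?uniq_nbrs// inE mem_nbrs => /andP[yz xy].
have [->|H] := neighbor_gdist o xy; first by rewrite Ex eq_sym.
case/negP: yz; apply/eqP.
by apply: (@closer_neighbor_unique o x); rewrite // ?oz Ex//; lia.
Qed.

Fixpoint ball_seq o n : seq V :=
  if n is m.+1 then undup (ball_seq o m ++ flatten (map nbrs (ball_seq o m)))
  else [:: o].

Lemma mem_ball_seq o n x : (x \in ball_seq o n) = (dist o x <= n).
Proof.
elim: n x => [|n IH] x; first by rewrite inE leqn0 gdist_eq0 eq_sym.
rewrite [ball_seq _ _]/= mem_undup mem_cat IH.
apply/idP/idP => [/orP[/leqW//|/flatten_mapP[y]]|].
  by rewrite IH mem_nbrs => oy /(gdist_edge_le o) H; rewrite (leq_trans H)// ltnS.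
rewrite leq_eqVlt => /orP[/eqP H|]; last by rewrite ltnS => ->.
have [y xy oy] := gdist_pred H.
by apply/orP; right; apply/flatten_mapP; exists y; rewrite ?IH ?oy// mem_nbrs Esym.
Qed.

Lemma uniq_ball_seq o n : uniq (ball_seq o n).
Proof. by case: n => // n; apply: undup_uniq. Qed.

Definition sphere o k : seq V := [seq x <- ball_seq o k | dist o x == k].

Lemma mem_sphere o k x : (x \in sphere o k) = (dist o x == k).
Proof. by rewrite mem_filter mem_ball_seq; case: eqP => //= ->; rewrite leqnn. Qed.

Lemma uniq_sphere o k : uniq (sphere o k).
Proof. by rewrite filter_uniq// uniq_ball_seq. Qed.

Lemma sphere0 o : sphere o 0 = [:: o].
Proof. by rewrite /sphere /= gdistxx. Qed.

Lemma perm_sphere1 o : perm_eq (sphere o 1) (nbrs o).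
Proof.
apply: uniq_perm; rewrite ?uniq_sphere ?uniq_nbrs// => x.
rewrite mem_sphere mem_nbrs; apply/eqP/idP; [exact: edge_gdist|exact: gdist_edge].
Qed.

Lemma sum_sphere (U : nmodType) (f : V -> U) o k s : uniq s ->
  (forall x, dist o x = k -> x \in s) ->
  (\sum_(x <- sphere o k) f x = \sum_(x <- s | dist o x == k) f x)%R.
Proof.
move=> us H; rewrite -[RHS]big_filter; apply: perm_big.
apply: uniq_perm; rewrite ?uniq_sphere ?filter_uniq// => x.
by rewrite mem_sphere mem_filter; case: eqP => // /H ->.
Qed.

(** Count, for every x, the neighbours of o at distance k + 1 from x: if x is not o,
    one neighbour of o is closer to x than o and all others are farther away. *)
Lemma sum_neighbor_spheres (U : nmodType) (f : V -> U) o k :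
  (\sum_(y <- nbrs o) \sum_(x <- sphere y k.+1) f x =
   \sum_(x <- sphere o k.+2) f x
   + (\sum_(x <- sphere o k) f x) *+ (if k is 0 then d else d.-1))%R.
Proof.
set s := ball_seq o k.+2.
have us : uniq s by apply: uniq_ball_seq.
transitivity (\sum_(x <- s) f x *+ count (fun y => dist x y == k.+1) (nbrs o))%R.
  transitivity (\sum_(y <- nbrs o) \sum_(x <- s) (if dist y x == k.+1 then f x else 0))%R.
    rewrite big_seq [RHS]big_seq; apply: eq_bigr => y; rewrite mem_nbrs => oy.
    rewrite -big_mkcond; apply: sum_sphere => // x H; rewrite mem_ball_seq.
    by have := gdist_triangle y o x; rewrite H (gdist_edge oy).
  rewrite exchange_big /=; apply: eq_bigr => x _.
  rewrite -big_mkcond /= big_const_seq iter_addr_0; congr (_ *+ _)%R.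
  by apply: eq_count => y; rewrite gdist_sym.
rewrite (@sum_sphere _ f o k.+2 s)//; last by move=> x H; rewrite mem_ball_seq H.
rewrite (@sum_sphere _ f o k s)//; last by move=> x H; rewrite mem_ball_seq H; lia.
rewrite -sumrMnl [X in (X + _)%R]big_mkcond [X in (_ + X)%R]big_mkcond -big_split /=.
apply: eq_bigr => x _; rewrite count_nbrs_gdist (gdist_sym x o).
case: (dist o x) => [|n]; rewrite ?eqSS.
  by case: k {s us} => [|k] /=; rewrite ?mul1n ?mul0n ?add0r ?mulr0n ?addr0.
case: k {s us} => [|k].
  by case: n => [|[|n]] /=; rewrite ?mul0n ?addn0 ?mulr1n ?addr0 ?mulr0n.
rewrite !eqSS mulrnDr; congr (_ + _)%R.
  by rewrite eq_sym; case: eqP; rewrite ?mulr1n ?mulr0n.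
by rewrite eq_sym; case: eqP; rewrite ?mul1n ?mul0n ?mulr0n.
Qed.

Lemma size_sphere o k : 1 < d -> size (sphere o k.+1) = d * d.-1 ^ k.
Proof.
move=> d1.
have sumE (s : seq V) : (\sum_(x <- s) 1 = (size s)%:R :> int)%R.
  by rewrite big_const_seq count_predT iter_addr_0.
elim: k {-2}k (leqnn k) o => [|m IH] [|k] //= km o.
  1,2: by rewrite (perm_size (perm_sphere1 o)) size_nbrs expn0 muln1.
have := @sum_neighbor_spheres int (fun=> 1%R) o k.
under eq_bigr => y _ do rewrite sumE (IH k km y).
rewrite !sumE big_const_seq count_predT iter_addr_0 size_nbrs => H.
have {}H : d * d.-1 ^ k * d = size (sphere o k.+2) + size (sphere o k) * (if k is 0 then d else d.-1).
  by apply/eqP; rewrite -(eqr_nat int) natrD !natrM; move: H; case: (k); lia.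
have dE : d = d.-1.+1 by lia.
case: k km H => [|k] km H.
  by move: H; rewrite sphere0 /= expn0 expn1 muln1 mul1n {1 2 4}dE; nia.
move: H; rewrite (IH k (ltnW km) o) [_ ^ k.+2]expnS expnS.
by move: (d.-1) (_ ^ k) dE => b t ->; nia.
Qed.


Definition parent u z : V := head z [seq p <- nbrs z | dist u p < dist u z].

Lemma parentE u z p : E z p -> dist u p < dist u z -> parent u z = p.
Proof.
move=> zp up; rewrite /parent.
have : p \in [seq p <- nbrs z | dist u p < dist u z] by rewrite mem_filter up mem_nbrs.
case H : [seq _ <- _ | _] => [//|q s] _ /=.
have : q \in [seq p <- nbrs z | dist u p < dist u z] by rewrite H inE eqxx.
rewrite mem_filter mem_nbrs => /andP[uq zq].
by apply: (@closer_neighbor_unique u z) => //; apply: ltnW.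
Qed.

Lemma parentP u z n : dist u z = n.+1 -> E z (parent u z) /\ dist u (parent u z) = n.
Proof.
by move=> H; have [y zy uy] := gdist_pred H; rewrite (@parentE _ _ y)// H uy.
Qed.

Definition children u z : seq V := [seq c <- nbrs z | dist u z < dist u c].

(** The neighbours of z away from the root u, those leading to v first.  This order
    is what makes [transport] send the geodesic from u to v to the one from x to y. *)
Definition ordered_children u v z : seq V :=
  [seq c <- children u z | dist v c < dist v z] ++
  [seq c <- children u z | ~~ (dist v c < dist v z)].

Lemma perm_ordered_children u v z : perm_eq (ordered_children u v z) (children u z).
Proof. exact/permPl/perm_filterC. Qed.

Lemma mem_children u z c :
  (c \in children u z) = E z c && (dist u c == (dist u z).+1).
Proof.
rewrite mem_filter mem_nbrs andbC; case zc: (E z c) => //=.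
by have [->|->] := neighbor_gdist u zc; [lia|lia].
Qed.

Lemma mem_ordered_children u v z c :
  (c \in ordered_children u v z) = E z c && (dist u c == (dist u z).+1).
Proof. by rewrite (perm_mem (perm_ordered_children u v z)) mem_children. Qed.

Lemma uniq_ordered_children u v z : uniq (ordered_children u v z).
Proof. by rewrite (perm_uniq (perm_ordered_children u v z)) filter_uniq// uniq_nbrs. Qed.

Lemma size_ordered_children u v z :
  size (ordered_children u v z) = if dist u z is 0 then d else d.-1.
Proof.
rewrite (perm_size (perm_ordered_children u v z)) size_filter.
rewrite (@eq_in_count _ _ (fun c => dist u c == (dist u z).+1)).
  rewrite count_nbrs_gdist; case: (dist u z) => [|n]; first by rewrite eqxx mul1n.
  by rewrite eqxx mul1n; case: eqP => //; lia.
move=> c; rewrite mem_nbrs => /(neighbor_gdist u); lia.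
Qed.

Section Transport.
Variables u v x y : V.

Fixpoint transport_upto n z : V :=
  if n is m.+1 then
    nth x (ordered_children x y (transport_upto m (parent u z)))
      (index z (ordered_children u v (parent u z)))
  else x.

(** The automorphism is defined along geodesics from u: it sends u to x and the i-th
    child of z to the i-th child of the image of z. *)
Definition transport z := transport_upto (dist u z) z.

Lemma transportS z n : dist u z = n.+1 ->
  transport z = nth x (ordered_children x y (transport (parent u z)))
      (index z (ordered_children u v (parent u z))).
Proof. by move=> H; rewrite /transport H (parentP H).2. Qed.

Lemma mem_parent_children w z n : dist u z = n.+1 ->
  z \in ordered_children u w (parent u z).
Proof.
by move=> H; have [zp up] := parentP H; rewrite mem_ordered_children Esym zp up H eqxx.
Qed.

Lemma gdist_transport z : dist x (transport z) = dist u z.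
Proof.
move En: (dist u z) => n; elim: n z En => [|n IH] z En.
  by rewrite /transport En gdistxx.
have [zp up] := parentP En; rewrite (transportS En).
set s := ordered_children x y _.
suff : nth x s (index z (ordered_children u v (parent u z))) \in s.
  by rewrite mem_ordered_children IH// => /andP[_ /eqP].
apply: mem_nth; rewrite size_ordered_children IH// -{1}up.
by rewrite -(size_ordered_children u v) index_mem (mem_parent_children _ En).
Qed.

Lemma transport_child z n : dist u z = n.+1 ->
  [/\ E (transport (parent u z)) (transport z),
      parent x (transport z) = transport (parent u z) &
      index (transport z) (ordered_children x y (transport (parent u z)))
      = index z (ordered_children u v (parent u z))].
Proof.
move=> En; have [zp up] := parentP En.
set s := ordered_children x y (transport (parent u z)).
set i := index z (ordered_children u v (parent u z)).
have si : i < size s.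
  rewrite size_ordered_children gdist_transport -(size_ordered_children u v) index_mem.
  exact: mem_parent_children En.
have Ez : transport z = nth x s i by apply: transportS En.
have := mem_nth x si; rewrite -Ez mem_ordered_children => /andP[pz /eqP xz].
split=> //; first by apply: parentE; rewrite ?xz// Esym.
by rewrite Ez index_uniq// uniq_ordered_children.
Qed.

Lemma transport_edge z w : E z w -> E (transport z) (transport w).
Proof.
wlog H : z w / dist u w = (dist u z).+1 => [hw zw|zw].
  have [H|H] := neighbor_gdist u zw; first exact: hw.
  by rewrite Esym; apply: hw; rewrite // Esym.
have [+ _ _] := transport_child H.
by rewrite (@parentE u w z)// ?H// Esym.
Qed.

Hypothesis same_dist : dist u v = dist x y.

(** On the geodesic from u to v the next vertex is the child with index 0, and so it
    is on the geodesic from x to y. *)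
Lemma gdist_transport_geodesic z :
  dist u z + dist v z = dist u v -> dist y (transport z) = dist v z.
Proof.
move En: (dist u z) => n; elim: n z En => [|n IH] z En.
  have -> : z = u by apply/eqP; rewrite eq_sym -gdist_eq0 En.
  by move=> _; rewrite /transport gdistxx /= (gdist_sym y) -same_dist; apply: gdist_sym.
move=> geo; have [zp up] := parentP En; set p := parent u z in zp up *.
have vp : dist v p = (dist v z).+1.
  have := gdist_triangle p u v; rewrite up -geo (gdist_sym p).
  have := gdist_edge_le v zp; lia.
have yp : dist y (transport p) = (dist v z).+1.
  by rewrite IH// vp; lia.
have xp : dist x (transport p) = n by rewrite gdist_transport.
have first s1 s2 c : all (pred1 c) s1 -> c \in s1 -> index c (s1 ++ s2) = 0.
  by case: s1 => // a s1 /= /andP[/eqP-> _] _; rewrite eqxx.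
have iz : index z (ordered_children u v p) = 0.
  apply: first; last by rewrite mem_filter vp leqnn mem_children Esym zp up En eqxx.
  apply/allP => c; rewrite mem_filter mem_children => /andP[vc /andP[pc _]] /=.
  apply/eqP; apply: (@closer_neighbor_unique v p) => //; rewrite ?(ltnW vc)//.
    by rewrite Esym.
  by rewrite vp.
have [c pc yc] := gdist_pred yp.
have xc : dist x c = n.+1.
  have [|H] := neighbor_gdist x pc; first by rewrite xp.
  have := gdist_triangle c x y; rewrite (gdist_sym c) yc -same_dist -geo.
  by move: H; rewrite xp; lia.
have ic : index c (ordered_children x y (transport p)) = 0.
  apply: first; last by rewrite mem_filter yp yc leqnn mem_children pc xp xc eqxx.
  apply/allP => a; rewrite mem_filter mem_children => /andP[ya /andP[pa _]] /=.
  apply/eqP; apply: (@closer_neighbor_unique y (transport p)) => //; rewrite ?(ltnW ya)//.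
  by rewrite yp yc.
rewrite (transportS En) -/p iz -[in nth _ _ _]ic nth_index//.
by rewrite mem_ordered_children pc xp xc eqxx.
Qed.

Lemma transport_target : transport v = y.
Proof.
apply/eqP; rewrite eq_sym -gdist_eq0 gdist_transport_geodesic ?gdistxx//.
by rewrite addn0.
Qed.

Lemma transport_source : transport u = x.
Proof. by rewrite /transport gdistxx. Qed.

End Transport.

Lemma transportK u v x y : cancel (transport u v x y) (transport x y u v).
Proof.
move=> z; move En: (dist u z) => n; elim: n z En => [|n IH] z En.
  have -> : z = u by apply/eqP; rewrite eq_sym -gdist_eq0 En.
  by rewrite !transport_source.
have [zp up] := parentP En.
have [_ pE iE] := transport_child v x y En.
rewrite (@transportS x y u v _ n) ?gdist_transport// pE IH// iE nth_index//.
exact: mem_parent_children En.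
Qed.

(** [transport] from (u, v) to (x, y) and back are inverse to each other. *)
Theorem two_point_homogeneous u v x y : dist u v = dist x y ->
  exists g : graph_aut E, g u = x /\ g v = y.
Proof.
move=> H.
have edge z w : E (transport u v x y z) (transport u v x y w) = E z w.
  apply/idP/idP => [|]; last exact: transport_edge.
  by move/(transport_edge x y u v); rewrite !transportK.
exists (GraphAut (transportK u v x y) (transportK x y u v) edge) => /=.
by rewrite transport_source transport_target.
Qed.

Lemma aut_gdist (g : graph_aut E) x y : dist (g x) (g y) = dist x y.
Proof.
have walk_aut (h : V -> V) n a b : (forall z w, E z w -> E (h z) (h w)) ->
    walk E n a b -> walk E n (h a) (h b).
  move=> hE [p [pp <- <-]]; exists (map h p); rewrite last_map size_map; split=> //.
  by apply: homo_path pp.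
apply/eqP; rewrite eqn_leq; apply/andP; split; apply: gdist_le.
  by apply: walk_aut (gdist_walk _ _) => z w; rewrite aut_edge.
rewrite -{2}(aut_funK g x) -{2}(aut_funK g y).
apply: (walk_aut (aut_inv g)) (gdist_walk _ _) => z w zw.
by rewrite -(aut_edge g) !(aut_invK g).
Qed.

End Tree.

(** * Expectations and covariances of bounded functions *)

Import numFieldNormedType.Exports.

Section BoundedExpectation.
Context d (T : measurableType d) (R : realType) (P : probability T R).
Implicit Types (f g : T -> R) (B : set T).

Definition bounded_measurable f :=
  measurable_fun setT f /\ exists M, forall w, `|f w| <= M.

(** The expectation as a real number; it is only used for bounded measurable
    functions. *)
Definition expect f : R := \int[P]_w f w.

Lemma bounded_measurable_integrable f : bounded_measurable f ->
  P.-integrable setT (EFin \o f).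
Proof.
move=> [mf [M Mf]]; apply: measurable_bounded_integrable => //.
  exact: le_lt_trans (probability_le1 P measurableT) (ltry 1).
exists M; split; first exact: num_real.
by move=> N MN w _; apply: le_trans (Mf w) (ltW MN).
Qed.

Lemma bounded_measurable_cst c : bounded_measurable (fun=> c).
Proof. by split => //; exists `|c|. Qed.

Lemma bounded_measurableD f g : bounded_measurable f -> bounded_measurable g ->
  bounded_measurable (fun w => f w + g w).
Proof.
move=> [mf [M Mf]] [mg [N Ng]]; split; first exact: measurable_funD.
by exists (M + N) => w; apply: le_trans (ler_normD _ _) (lerD _ _).
Qed.

Lemma bounded_measurableM f g : bounded_measurable f -> bounded_measurable g ->
  bounded_measurable (fun w => f w * g w).
Proof.
move=> [mf [M Mf]] [mg [N Ng]]; split; first exact: measurable_funM.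
by exists (M * N) => w; rewrite normrM ler_pM.
Qed.

Lemma bounded_measurableZ c f : bounded_measurable f ->
  bounded_measurable (fun w => c * f w).
Proof. by move=> mf; apply: bounded_measurableM => //; apply: bounded_measurable_cst. Qed.

Lemma bounded_measurable_indic B : measurable B -> bounded_measurable (\1_B).
Proof.
move=> mB; split; first exact: measurable_indic.
by exists 1 => w; rewrite indicE; case: (_ \in _); rewrite ?normr1 ?normr0.
Qed.

Lemma bounded_measurable_sum (I : Type) (s : seq I) (F : I -> T -> R) :
  (forall i, bounded_measurable (F i)) ->
  bounded_measurable (fun w => \sum_(i <- s) F i w).
Proof.
move=> mF; elim: s => [|i s IH].
  by under eq_fun do rewrite big_nil; apply: bounded_measurable_cst.
by under eq_fun do rewrite big_cons; apply: bounded_measurableD.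
Qed.

Lemma expectD f g : bounded_measurable f -> bounded_measurable g ->
  expect (fun w => f w + g w) = expect f + expect g.
Proof. by move=> mf mg; rewrite /expect RintegralD//; apply: bounded_measurable_integrable. Qed.

Lemma expectZ c f : bounded_measurable f -> expect (fun w => c * f w) = c * expect f.
Proof. by move=> mf; rewrite /expect RintegralZl//; apply: bounded_measurable_integrable. Qed.

Lemma expect_cst c : expect (fun=> c) = c.
Proof. by rewrite /expect Rintegral_cst// -[fine _]/(fine (P setT)) probability_setT mulr1. Qed.

Lemma expect_ge0 f : (forall w, 0 <= f w) -> 0 <= expect f.
Proof. by move=> f0; apply: Rintegral_ge0. Qed.

Lemma expect_indic B : measurable B -> expect \1_B = fine (P B).
Proof. by move=> mB; rewrite /expect /Rintegral integral_indic// setIT. Qed.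

Lemma expect_sum (I : Type) (s : seq I) (F : I -> T -> R) :
  (forall i, bounded_measurable (F i)) ->
  expect (fun w => \sum_(i <- s) F i w) = \sum_(i <- s) expect (F i).
Proof.
move=> mF; elim: s => [|i s IH].
  by rewrite big_nil -[RHS]expect_cst; congr expect; apply: funext => w; rewrite big_nil.
rewrite big_cons -IH -expectD//; last exact: bounded_measurable_sum.
by congr expect; apply: funext => w; rewrite big_cons.
Qed.

Lemma expectB f g : bounded_measurable f -> bounded_measurable g ->
  expect (fun w => f w - g w) = expect f - expect g.
Proof.
move=> mf mg; rewrite -[- expect g]mulN1r -expectZ// -expectD//; last exact: bounded_measurableZ.
by congr expect; apply: funext => w; rewrite mulN1r.
Qed.

Lemma expect_le f g : bounded_measurable f -> bounded_measurable g ->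
  (forall w, f w <= g w) -> expect f <= expect g.
Proof.
by move=> mf mg fg; rewrite -subr_ge0 -expectB//; apply: expect_ge0 => w; rewrite subr_ge0.
Qed.

Lemma expectationE f : bounded_measurable f -> 'E_P[f]%E = (expect f)%:E.
Proof.
move=> mf; rewrite /expect /Rintegral unlock fineK//.
exact: (integrable_fin_num _ (bounded_measurable_integrable mf)).
Qed.

Definition cov f g : R := expect (fun w => f w * g w) - expect f * expect g.

Lemma covE f g : cov f g = expect (fun w => f w * g w) - expect f * expect g.
Proof. by []. Qed.

Lemma covC f g : cov f g = cov g f.
Proof.
rewrite /cov [expect g * _]mulrC; congr (_ - _).
by congr expect; apply: funext => w; rewrite mulrC.
Qed.

Lemma covDr f g h : bounded_measurable f -> bounded_measurable g -> bounded_measurable h ->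
  cov f (fun w => g w + h w) = cov f g + cov f h.
Proof.
move=> mf mg mh; rewrite /cov expectD//.
have -> : expect (fun w => f w * (g w + h w))
    = expect (fun w => f w * g w) + expect (fun w => f w * h w).
  rewrite -expectD; [|exact: bounded_measurableM..].
  by congr expect; apply: funext => w; rewrite mulrDr.
ring.
Qed.

Lemma covZr f g c : bounded_measurable f -> bounded_measurable g ->
  cov f (fun w => c * g w) = c * cov f g.
Proof.
move=> mf mg; rewrite /cov expectZ//.
have -> : expect (fun w => f w * (c * g w)) = c * expect (fun w => f w * g w).
  rewrite -expectZ; last exact: bounded_measurableM.
  by congr expect; apply: funext => w; rewrite mulrCA.
ring.
Qed.

Lemma cov_cstr f c : bounded_measurable f -> cov f (fun=> c) = 0.
Proof.
move=> mf; rewrite /cov expect_cst.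
have -> : expect (fun w => f w * c) = c * expect f.
  by rewrite -expectZ//; congr expect; apply: funext => w; rewrite mulrC.
ring.
Qed.

Lemma cov_sumr (I : Type) (s : seq I) f (F : I -> T -> R) :
  bounded_measurable f -> (forall i, bounded_measurable (F i)) ->
  cov f (fun w => \sum_(i <- s) F i w) = \sum_(i <- s) cov f (F i).
Proof.
move=> mf mF; elim: s => [|i s IH].
  rewrite big_nil -[RHS](cov_cstr 0 mf); congr (cov _ _).
  by apply: funext => w; rewrite big_nil.
rewrite big_cons -IH -covDr//; last exact: bounded_measurable_sum.
by congr (cov _ _); apply: funext => w; rewrite big_cons.
Qed.

Lemma cov_expect f g : bounded_measurable f -> bounded_measurable g ->
  cov f g = expect (fun w => (f w - expect f) * g w).
Proof.
move=> mf mg.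
rewrite /cov -[expect f * _]expectZ// -expectB; last 2 first.
- exact: bounded_measurableM.
- exact: bounded_measurableZ.
by congr expect; apply: funext => w; rewrite mulrBl.
Qed.

Lemma var_ge0 f : bounded_measurable f -> 0 <= cov f f.
Proof.
move=> mf; have mc : bounded_measurable (fun w => f w - expect f).
  by apply: bounded_measurableD => //; apply: bounded_measurable_cst.
suff -> : cov f f = expect (fun w => (f w - expect f) ^+ 2).
  by apply: expect_ge0 => w; rewrite sqr_ge0.
rewrite -[LHS]addr0 -(cov_cstr (- expect f) mf) -covDr//; last exact: bounded_measurable_cst.
rewrite cov_expect//; congr expect; apply: funext => w; by rewrite expr2.
Qed.

Lemma cov_CS f g : bounded_measurable f -> bounded_measurable g ->
  cov f g ^+ 2 <= cov f f * cov g g.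
Proof.
move=> mf mg; apply: discriminant_le => s t.
have mh : bounded_measurable (fun w => s * f w + t * g w).
  by apply: bounded_measurableD; apply: bounded_measurableZ.
have := var_ge0 mh.
rewrite covDr ?(covZr _ mh)//; [|exact: bounded_measurableZ..].
rewrite (covC _ f) (covC _ g) !covDr ?covZr//; [|exact: bounded_measurableZ..].
rewrite (covC g f); lra.
Qed.

End BoundedExpectation.

(** * Local functions of configurations *)

Section Configurations.
Variables (R : realType) (V : choiceType) (A : finType) (a0 : A).
Local Notation Omega := (borel_config V a0).
Implicit Types (K : {fset V}) (w t : V -> A).

Definition agree K t : set Omega := [set w : V -> A | forall x, x \in K -> w x = t x].

Definition depends_on (B : Type) K (f : (V -> A) -> B) :=
  forall w w', (forall x, x \in K -> w x = w' x) -> f w = f w'.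

Lemma coordinate_measurable x a : measurable ([set w : V -> A | w x = a] : set Omega).
Proof.
pose p : prod_topology (fun _ : V => discrete_topology A) -> discrete_topology A :=
  fun w => w x.
have /continuousP H : continuous p by exact: (@proj_continuous V (fun=> discrete_topology A) x).
apply: sub_sigma_algebra; exact: (H [set a] (discrete_open _)).
Qed.

Lemma agree_measurable K t : measurable (agree K t).
Proof.
have -> : agree K t = \bigcap_(x in [set` K]) [set w : V -> A | w x = t x].
  by apply/seteqP; split => w H x xK; apply: H.
by apply: fin_bigcap_measurable => // x _; apply: coordinate_measurable.
Qed.

Lemma indic_agree_bounded K t : bounded_measurable (\1_(agree K t) : Omega -> R).
Proof. exact: bounded_measurable_indic (agree_measurable K t). Qed.

Lemma gluing_in K (s : {ffun K -> A}) t (x : K) : gluing s t (val x) = s x.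
Proof. by rewrite /gluing valK. Qed.

Lemma gluing_out K (s : {ffun K -> A}) t x : x \notin K -> gluing s t x = t x.
Proof. by move=> xK; rewrite /gluing insubN. Qed.

(** Sort the configurations that agree with t on K by their restriction to D. *)
Lemma agree_split K D t w : [disjoint K & D]%fset ->
  \1_(agree K t) w = \sum_(s : {ffun D -> A}) \1_(agree (K `|` D)%fset (gluing s t)) w :> R.
Proof.
move=> KD; pose s0 : {ffun D -> A} := [ffun x => w (val x)].
have notD x : x \in K -> x \notin D by move=> xK; have /fdisjointP := KD; apply.
rewrite (bigD1 s0) //= big1 ?addr0 => [|s ss0].
  rewrite !indicE; congr (_%:R); congr nat_of_bool; apply/idP/idP; rewrite !inE => H x.
    rewrite in_fsetU => /orP[xK|xD]; first by rewrite gluing_out ?notD// H.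
    by rewrite (gluing_in s0 t [` xD]%fset) ffunE.
  by move=> xK; rewrite H ?in_fsetU ?xK// gluing_out// notD.
rewrite indicE; case: (boolP (w \in _)) => //; rewrite inE => H.
case/eqP: ss0; apply/ffunP => x; rewrite ffunE -(gluing_in s t) H//.
by rewrite in_fsetU (valP x) orbT.
Qed.

Lemma local_decomposition K (f : (V -> A) -> R) t : depends_on K f -> forall w,
  f w = \sum_(s : {ffun K -> A}) f (gluing s t) * \1_(agree K (gluing s t)) w.
Proof.
move=> fK w.
have H := agree_split t w (fdisjoint0X K); rewrite fset0U in H.
transitivity (f w * \1_(agree fset0 t) w).
  by rewrite indicE mem_set ?mulr1.
rewrite H mulr_sumr; apply: eq_bigr => s _; rewrite indicE.
case: (boolP (w \in _)); rewrite ?mulr0// !mulr1 inE => ws.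
exact: fK.
Qed.

Lemma local_bounded_measurable K (f : (V -> A) -> R) : depends_on K f ->
  bounded_measurable (f : Omega -> R).
Proof.
move=> fK; have -> : f = fun w => \sum_(s : {ffun K -> A})
    f (gluing s (fun=> a0)) * \1_(agree K (gluing s (fun=> a0))) w.
  by apply: funext => w; rewrite {1}(local_decomposition (fun=> a0) fK).
apply: bounded_measurable_sum => s; apply: bounded_measurableZ.
exact: indic_agree_bounded.
Qed.

Lemma expect_local (P : probability Omega R) K (f : (V -> A) -> R) t : depends_on K f ->
  expect P f = \sum_(s : {ffun K -> A}) f (gluing s t) * fine (P (agree K (gluing s t))).
Proof.
move=> fK.
transitivity (expect P (fun w => \sum_(s : {ffun K -> A})
    f (gluing s t) * \1_(agree K (gluing s t)) w)).
  by congr expect; apply: funext => w; rewrite {1}(local_decomposition t fK).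
rewrite expect_sum => [|s]; last first.
  exact/bounded_measurableZ/indic_agree_bounded.
apply: eq_bigr => s _; rewrite expectZ; last exact: indic_agree_bounded.
by rewrite expect_indic//; apply: agree_measurable.
Qed.

End Configurations.

(** * Limits of dominated probabilities along an ultrafilter *)

(** A cluster point, which exists by compactness, is a limit because every set or its
    complement is in the ultrafilter. *)
Lemma ultrafilter_bounded_cvg (R : realType) (I : Type) (U : set_system I)
    (u : I -> R) (M : R) : UltraFilter U -> (forall i, `|u i| <= M) ->
  exists l : R, u @ U --> l.
Proof.
move=> UU uM.
have PU : ProperFilter U by apply: ultra_proper.
have uI : U (u @^-1` `[- M, M]%classic).
  by apply: filterE => i; rewrite /preimage /= in_itv /= -ler_norml.
have [l [_ cl]] := @segment_compact R (- M) M (u @ U) _ uI.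
exists l => W Wl.
have [//|H] := in_ultra_setVsetC (u @^-1` W) UU.
by have [x [nWx Wx]] := cl (~` W) W H Wl.
Qed.

Section UltraLimit.
Context d (T : measurableType d) (R : realType) (nu : probability T R).
Variables (q : nat -> set T -> R) (C : R).
Hypothesis q_ge0 : forall n B, measurable B -> 0 <= q n B.
Hypothesis q_le : forall n B, measurable B -> q n B <= C * fine (nu B).
Hypothesis q_add : forall n A B, measurable A -> measurable B ->
  A `&` B = set0 -> q n (A `|` B) = q n A + q n B.
Hypothesis qT : forall n, q n setT = 1.
Variable U : set_system nat.
Hypothesis UU : UltraFilter U.

Let PU : ProperFilter U := ultra_proper.

Definition ultralim B : R := lim (q n B @[n --> U]).

Lemma ultralim_cvg B : measurable B -> q n B @[n --> U] --> ultralim B.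
Proof.
move=> mB; apply/cvg_ex.
apply: (@ultrafilter_bounded_cvg R nat U (q ^~ B) (C * fine (nu B))) => // i.
by rewrite ger0_norm ?q_le// q_ge0.
Qed.

Lemma ultralim_ge0 B : measurable B -> 0 <= ultralim B.
Proof.
move=> mB; apply: (limr_ge (x := 0)); first by apply/cvg_ex; exists (ultralim B); apply: ultralim_cvg.
by apply: nearW => n; apply: q_ge0.
Qed.

Lemma ultralim_le B : measurable B -> ultralim B <= C * fine (nu B).
Proof.
move=> mB; apply: limr_le; first by apply/cvg_ex; exists (ultralim B); apply: ultralim_cvg.
by apply: nearW => n; apply: q_le.
Qed.

Lemma ultralim_add A B : measurable A -> measurable B -> A `&` B = set0 ->
  ultralim (A `|` B) = ultralim A + ultralim B.
Proof.
move=> mA mB AB.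
have H := cvgD (ultralim_cvg mA) (ultralim_cvg mB).
have E : (fun n => q n (A `|` B)) = (fun n => q n A + q n B).
  by apply: funext => n; apply: q_add.
rewrite /ultralim E; exact: (cvg_lim (@norm_hausdorff _ _) (H _)).
Qed.

Lemma ultralimT : ultralim setT = 1.
Proof.
have E : (fun n => q n setT) = (fun=> 1) by apply: funext => n; apply: qT.
by rewrite /ultralim E; apply: cvg_lim => //; apply: cvg_cst.
Qed.

Lemma ultralim0 : ultralim set0 = 0.
Proof.
by apply/eqP; rewrite eq_le ultralim_ge0// andbT (le_trans (ultralim_le _))// measure0 mulr0.
Qed.

(** The value 0 on sets that are not measurable is arbitrary; it makes the function
    nonnegative on all sets. *)
Definition ultralimit_measure B : \bar R :=
  if `[< measurable B >] then (ultralim B)%:E else 0%E.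

Lemma ultralimit_measureE B : measurable B -> ultralimit_measure B = (ultralim B)%:E.
Proof. by move=> mB; rewrite /ultralimit_measure asboolT. Qed.

Let m0 : ultralimit_measure set0 = 0%E.
Proof. by rewrite ultralimit_measureE// ultralim0. Qed.

Let m_ge0 B : (0 <= ultralimit_measure B)%E.
Proof.
rewrite /ultralimit_measure; case: asboolP => // mB.
by rewrite lee_fin ultralim_ge0.
Qed.

Let fin_nu B : measurable B -> (nu B \is a fin_num).
Proof. by move=> mB; apply: fin_num_measure. Qed.

Let additive_bigsetU (g : set T -> R) (F : nat -> set T) n : g set0 = 0 ->
  (forall A B, measurable A -> measurable B -> A `&` B = set0 -> g (A `|` B) = g A + g B) ->
  (forall i, measurable (F i)) -> trivIset setT F ->
  g (\big[setU/set0]_(i < n) F i) = \sum_(i < n) g (F i).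
Proof.
move=> g0 gD mF tF; elim: n => [|n IH]; first by rewrite !big_ord0.
rewrite !big_ord_recr /= gD ?IH//; first exact: bigsetU_measurable.
have tF' : trivIset [set` predT] F by apply: sub_trivIset tF.
by have := @trivIset_bigsetUI _ predT _ tF' n n isT (leqnn n).
Qed.

Let fine_nu_add A B : measurable A -> measurable B -> A `&` B = set0 ->
  fine (nu (A `|` B)) = fine (nu A) + fine (nu B).
Proof. by move=> mA mB AB; rewrite measureU// fineD// fin_nu. Qed.

(** The limit of finitely additive functions is finitely additive; domination by a
    multiple of nu makes the tails of a disjoint union tend to 0. *)
Let m_semi_sigma_additive : semi_sigma_additive ultralimit_measure.
Proof.
move=> F mF tF mU.
pose Fn n := \big[setU/set0]_(i < n) F i.
have mFn n : measurable (Fn n) by apply: bigsetU_measurable.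
(* The tail of the union, whose measure tends to 0. *)
pose tl n := (\bigcup_i F i) `\` Fn n.
have mtl n : measurable (tl n) by apply: measurableD.
have FnU n : \bigcup_i F i = Fn n `|` tl n.
  by rewrite /tl setDUK//; apply: bigsetU_bigcup.
have FnI n : Fn n `&` tl n = set0 by rewrite /tl setDE setICA setICr setI0.
rewrite ultralimit_measureE//.
have -> : (fun n => \sum_(0 <= i < n) ultralimit_measure (F i))%E
    = EFin \o (fun n => ultralim (Fn n)).
  apply: funext => n /=; rewrite (additive_bigsetU n ultralim0 ultralim_add mF tF).
  rewrite big_mkord -sumEFin; apply: eq_bigr => i _; exact: ultralimit_measureE.
apply: cvg_EFin; first exact: nearW.
have cnu : fine (nu (Fn n)) @[n --> \oo] --> fine (nu (\bigcup_i F i)).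
  have := @measure_semi_sigma_additive _ _ _ nu F mF tF mU.
  rewrite -[X in _ --> X](fineK (fin_nu mU)) => /fine_cvg; apply: cvg_trans.
  apply: near_eq_cvg; apply: nearW => n /=.
  rewrite (additive_bigsetU n _ fine_nu_add mF tF) ?measure0//.
  by rewrite big_mkord sum_fine// => i _; apply: fin_nu.
have lo : ultralim (\bigcup_i F i) - C * (fine (nu (\bigcup_i F i)) - fine (nu (Fn n)))
    @[n --> \oo] --> ultralim (\bigcup_i F i).
  rewrite -[X in _ --> X]subr0 -(mulr0 C) -(subrr (fine (nu (\bigcup_i F i)))).
  by apply: cvgB; [exact: cvg_cst|apply: cvgMr; apply: cvgB; [exact: cvg_cst|]].
apply: (squeeze_cvgr _ lo (cvg_cst (ultralim (\bigcup_i F i)))).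
apply: nearW => n.
have E1 : ultralim (\bigcup_i F i) = ultralim (Fn n) + ultralim (tl n).
  by rewrite {1}(FnU n) ultralim_add.
have E2 : fine (nu (\bigcup_i F i)) = fine (nu (Fn n)) + fine (nu (tl n)).
  by rewrite {1}(FnU n) fine_nu_add.
have := ultralim_ge0 (mtl n); have := ultralim_le (mtl n).
rewrite E1 E2 /= => H1 H2.
by apply/andP; split; lra.
Qed.

HB.instance Definition _ := isMeasure.Build _ _ _ ultralimit_measure
  m0 m_ge0 m_semi_sigma_additive.

Let m_setT : ultralimit_measure setT = 1%E.
Proof. by rewrite ultralimit_measureE// ultralimT. Qed.

HB.instance Definition _ := Measure_isProbability.Build _ _ _ ultralimit_measure m_setT.

Definition ultralimit_probability : probability T R := ultralimit_measure.

Lemma ultralimit_probability_cvg B : measurable B ->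
  q n B @[n --> U] --> fine (ultralimit_probability B).
Proof.
by move=> mB; rewrite /ultralimit_probability /= ultralimit_measureE//; apply: ultralim_cvg.
Qed.

End UltraLimit.

(** * Gibbs measures through ratios of probabilities *)

Lemma pr_eqP (V : choiceType) (A : finType) (W : set V) (w t : V -> A) :
  pr w = pr t :> (W -> A) <-> forall x, W x -> w x = t x.
Proof.
split=> [H x Wx|H].
  by have := congr1 (fun f => f (exist _ x (mem_set Wx))) H.
by apply: funext => -[x Wx]; apply: H; apply: set_mem.
Qed.

Lemma factors_throughP (V : choiceType) (A : finType) (B : Type) (W : set V)
    (f : (V -> A) -> B) w w' : factors_through W f ->
  (forall x, W x -> w x = w' x) -> f w = f w'.
Proof. by move=> [f' fE] H; rewrite !fE; congr f'; apply/pr_eqP. Qed.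

Lemma fdisjointDX (T : choiceType) (X Y : {fset T}) : [disjoint (X `\` Y)%fset & Y]%fset.
Proof. by apply/fdisjointP => x; rewrite in_fsetD => /andP[]. Qed.

Section GibbsRatio.
Variables (R : realType) (d : nat) (V : choiceType) (E : rel V).
Hypothesis hT : regular_tree E d.
Variables (A : finType) (a0 : A) (psi : V -> (V -> A) -> R) (r : nat).
Hypothesis psi_range : has_range E r psi.
Local Notation Omega := (borel_config V a0).
Local Notation dist := (gdist E).
Local Notation agree := (@agree V A a0).
Implicit Types (S K : {fset V}) (w t : V -> A).

Definition nbhd_fset n S : {fset V} :=
  [fset y in flatten [seq ball_seq E x n | x <- enum_fset S]]%fset.

Lemma nbhd_fsetP n S y :
  reflect (exists2 x, x \in S & (dist x y <= n)%N) (y \in nbhd_fset n S).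
Proof.
rewrite inE; apply: (iffP flatten_mapP) => -[x xS H]; exists x => //.
  by rewrite -(mem_ball_seq hT).
by rewrite (mem_ball_seq hT).
Qed.

Lemma sub_nbhd_fset n S x : x \in S -> x \in nbhd_fset n S.
Proof. by move=> xS; apply/nbhd_fsetP; exists x => //; rewrite gdistxx. Qed.

Lemma set_nbhd_fset n S : [set` S] `|` gboundary E n [set` S] = [set` nbhd_fset n S].
Proof.
apply/seteqP; split => y /=.
  case=> [yS|[_ [x xS xy]]]; first exact: sub_nbhd_fset.
  by apply/nbhd_fsetP; exists x.
move/nbhd_fsetP => H; case: (boolP (y \in S)) => yS; [by left|right].
by split; [exact/negP|case: H => x; exists x].
Qed.

Lemma gboundary_fset n S : gboundary E n [set` S] = [set` (nbhd_fset n S `\` S)%fset].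
Proof.
apply/seteqP; split => y /=.
  by move=> [/negP yS [x xS xy]]; rewrite in_fsetD yS; apply/nbhd_fsetP; exists x.
rewrite in_fsetD => /andP[yS /nbhd_fsetP[x xS xy]]; split; first exact/negP.
by exists x.
Qed.

Definition energy S w : R := \sum_(v <- nbhd_fset r S) psi v w.

Definition weight S w : R := expR (- energy S w).

Lemma weight_gt0 S w : 0 < weight S w. Proof. exact: expR_gt0. Qed.

Lemma boltzmannE S (s : {ffun S -> A}) t : boltzmann E psi r s t = weight S (gluing s t).
Proof.
by rewrite /boltzmann /weight /energy set_nbhd_fset -fsbig_seq ?fset_uniq.
Qed.

Lemma psi_depends v w w' : (forall x, (dist v x <= r)%N -> w x = w' x) ->
  psi v w = psi v w'.
Proof. by move=> H; apply: factors_throughP (psi_range v) _ => x; apply: H. Qed.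

Lemma weight_depends S : depends_on (nbhd_fset (2 * r) S) (weight S).
Proof.
move=> w w' H; congr (expR (- _)).
rewrite /energy big_seq [RHS]big_seq; apply: eq_bigr => v /nbhd_fsetP[x xS xv].
apply: psi_depends => y vy; apply: H; apply/nbhd_fsetP; exists x => //.
by rewrite (leq_trans (gdist_triangle hT v _ _))// mul2n -addnn leq_add.
Qed.

(** The terms of the energy that are not within distance r of S do not see the
    difference between two configurations that agree outside S. *)
Lemma weight_ratio S S' w1 w2 : {subset S <= S'} ->
  (forall x, x \notin S -> w1 x = w2 x) ->
  weight S' w1 * weight S w2 = weight S' w2 * weight S w1.
Proof.
move=> SS' w12; rewrite -!expRD; congr expR.
suff H : energy S' w1 - energy S w1 = energy S' w2 - energy S w2 by lra.
have sub v : v \in nbhd_fset r S -> v \in nbhd_fset r S'.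
  by move=> /nbhd_fsetP[x /SS' xS xv]; apply/nbhd_fsetP; exists x.
have energyE w : energy S' w - energy S w =
    \sum_(v <- nbhd_fset r S' | v \notin nbhd_fset r S) psi v w.
  rewrite /energy [\sum_(v <- nbhd_fset r S') _](bigID (mem (nbhd_fset r S))) /=.
  rewrite addrC -addrA [X in _ + X](_ : _ = 0) ?addr0//.
  rewrite -big_filter; apply/eqP; rewrite subr_eq0; apply/eqP; apply: perm_big.
  apply: uniq_perm; rewrite ?filter_uniq ?fset_uniq// => v.
  by rewrite mem_filter /=; case: (boolP (v \in nbhd_fset r S)) => // /sub vS; rewrite vS.
rewrite !energyE; apply: eq_bigr => v vS; apply: psi_depends => x vx; apply: w12.
by apply: contra vS => xS; apply/nbhd_fsetP; exists x => //; rewrite (gdist_sym hT).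
Qed.

Definition boundary_event S t : set Omega :=
  [set w : V -> A | pr w = pr t :> (gboundary E (2 * r) [set` S] -> A)].

Lemma boundary_eventE S t :
  boundary_event S t = agree (nbhd_fset (2 * r) S `\` S)%fset t.
Proof.
rewrite /boundary_event gboundary_fset; apply/seteqP; split => w /=.
  by move/pr_eqP.
by move=> H; apply/pr_eqP.
Qed.

Lemma boundary_event_measurable S t : measurable (boundary_event S t).
Proof. by rewrite boundary_eventE; apply: agree_measurable. Qed.

Lemma cylinder_boundary S (s : {ffun S -> A}) t :
  cylinder s `&` boundary_event S t = agree (nbhd_fset (2 * r) S) (gluing s t) :> set Omega.
Proof.
rewrite boundary_eventE; apply/seteqP; split => w.
  move=> [ws wt] x xN; case: (boolP (x \in S)) => xS.
    by rewrite (gluing_in s t [` xS]%fset) -ws.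
  by rewrite gluing_out// wt// in_fsetD xS.
move=> H; split.
  by move=> x; rewrite H ?gluing_in//; apply: sub_nbhd_fset; apply: valP.
by move=> x; rewrite in_fsetD => /andP[xS xN]; rewrite H// gluing_out.
Qed.

(** The Gibbs condition without normalisation: changing a configuration inside S
    changes its probability by the ratio of the Boltzmann weights.  Unlike quotients of
    probabilities, this identity is linear in the measure and passes to limits. *)
Definition prob_ratio (mu : probability Omega R) := forall S w1 w2,
  (forall x, x \notin S -> w1 x = w2 x) ->
  fine (mu (agree (nbhd_fset (2 * r) S) w1)) * weight S w2 =
  fine (mu (agree (nbhd_fset (2 * r) S) w2)) * weight S w1.

Definition restrict_fset S w : {ffun S -> A} := [ffun x => w (val x)].

Lemma gluing_restrict S w : gluing (restrict_fset S w) w = w.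
Proof.
apply: funext => x; rewrite /gluing; case: insubP => // u _ <-.
by rewrite ffunE.
Qed.

Lemma fine_mu_ge0 (mu : probability Omega R) (B : set Omega) : 0 <= fine (mu B).
Proof. exact: fine_ge0. Qed.

Lemma fine_mu_le (mu : probability Omega R) (B C : set Omega) : measurable B -> measurable C ->
  B `<=` C -> fine (mu B) <= fine (mu C).
Proof.
move=> mB mC BC; apply: fine_le; rewrite ?fin_num_measure//.
by apply: le_measure; rewrite ?inE.
Qed.

(** The normalising sums of two configurations that agree outside S are equal; if the
    boundary event has probability 0, both sides vanish. *)
Lemma gibbs_prob_ratio mu : gibbs E psi r mu -> prob_ratio mu.
Proof.
move=> Hmu S w1 w2 w12.
pose s1 := restrict_fset S w1; pose s2 := restrict_fset S w2.
have gl (s : {ffun S -> A}) : gluing s w1 = gluing s w2 :> (V -> A).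
  by apply: funext => x; rewrite /gluing; case: insubP => // xS; apply: w12.
have Bw : boundary_event S w2 = boundary_event S w1.
  rewrite !boundary_eventE; apply/seteqP; split => w H x.
    by move=> xN; rewrite H// w12//; move: xN; rewrite in_fsetD => /andP[].
  by move=> xN; rewrite H// w12//; move: xN; rewrite in_fsetD => /andP[].
have C1 : cylinder s1 `&` boundary_event S w1 = agree (nbhd_fset (2 * r) S) w1.
  by rewrite cylinder_boundary gluing_restrict.
have C2 : cylinder s2 `&` boundary_event S w1 = agree (nbhd_fset (2 * r) S) w2.
  by rewrite -Bw cylinder_boundary gluing_restrict.
have [b0|b0] := eqVneq (fine (mu (boundary_event S w1))) 0.
  have z w (s : {ffun S -> A}) : cylinder s `&` boundary_event S w1 = agree (nbhd_fset (2 * r) S) w ->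
      fine (mu (agree (nbhd_fset (2 * r) S) w)) = 0.
    move=> CE; apply/eqP; rewrite eq_le fine_mu_ge0 andbT -b0.
    apply: fine_mu_le; [exact: agree_measurable|exact: boundary_event_measurable|].
    by rewrite -CE; apply: subIsetr.
  by rewrite (z _ _ C1) (z _ _ C2) !mul0r.
have bpos : (0 < mu (boundary_event S w1))%E.
  rewrite lt_neqAle measure_ge0 andbT eq_sym; apply: contra b0 => /eqP ->.
  exact/eqP.
have H1 := Hmu S s1 w1 bpos; have H2 := Hmu S s2 w1 bpos.
move: H1 H2; rewrite /cond_prob -/(boundary_event S w1) C1 C2.
rewrite !boltzmannE gluing_restrict gl gluing_restrict.
set Z := (\sum_(s' : {ffun S -> A}) _)%R.
move=> /(congr1 (fun x => x * fine (mu (boundary_event S w1)))); rewrite divfK// => ->.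
move=> /(congr1 (fun x => x * fine (mu (boundary_event S w1)))); rewrite divfK// => ->.
ring.
Qed.

(** Sum the ratios over all configurations inside S; the probabilities add up to
    that of the boundary event. *)
Lemma prob_ratio_gibbs mu : prob_ratio mu -> gibbs E psi r mu.
Proof.
move=> Hmu S s t B; rewrite -/(boundary_event S t) in B *.
move=> Bpos; rewrite /cond_prob cylinder_boundary.
set N := nbhd_fset (2 * r) S.
have BE : fine (mu B) = \sum_(s' : {ffun S -> A}) fine (mu (agree N (gluing s' t))).
  rewrite -expect_indic; last exact: boundary_event_measurable.
  rewrite /B boundary_eventE.
  have -> : \1_(agree (N `\` S)%fset t) = (fun w => \sum_(s' : {ffun S -> A})
      \1_(agree N (gluing s' t)) w) :> (Omega -> R).
    apply: funext => w.
    have -> := @agree_split R V A a0 (N `\` S)%fset S t w _; last first.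
      by apply: fdisjointDX.
    apply: eq_bigr => s' _; congr (\1_(agree _ _) w).
    apply/fsetP => x; rewrite in_fsetU in_fsetD.
    case: (boolP (x \in S)) => //= xS; first by rewrite sub_nbhd_fset.
    by rewrite orbF.
  rewrite expect_sum => [|s']; last exact: indic_agree_bounded.
  by apply: eq_bigr => s' _; rewrite expect_indic//; apply: agree_measurable.
have B0 : fine (mu B) != 0.
  rewrite gt_eqF// fine_gt0// Bpos /= -ge0_fin_numE ?measure_ge0// fin_num_measure//.
  exact: boundary_event_measurable.
have Z0 : \sum_(s' : {ffun S -> A}) boltzmann E psi r s' t != 0.
  rewrite gt_eqF// (bigD1 s)//= ltr_pwDl//; first by rewrite boltzmannE weight_gt0.
  by apply: sumr_ge0 => s' _; rewrite boltzmannE ltW// weight_gt0.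
apply/eqP; rewrite eqr_div// BE mulr_sumr mulr_sumr; apply/eqP.
apply: eq_bigr => s' _; rewrite !boltzmannE [RHS]mulrC; apply: Hmu => x xS.
by rewrite !gluing_out.
Qed.

(** The identity of [prob_ratio] still holds in the presence of a function G of the
    spins in a finite set W away from S: apply it to the union of S and W, where G is
    constant, and sum over the spins in the rest of the neighbourhood, using
    [weight_ratio] to return to the weights of S. *)
Lemma dlr_local (mu : probability Omega R) S W (G : (V -> A) -> R) w1 w2 :
  prob_ratio mu -> [disjoint S & W]%fset -> depends_on W G ->
  (forall x, x \notin S -> w1 x = w2 x) ->
  let N := nbhd_fset (2 * r) S in
  expect mu (fun w => \1_(agree N w1 : set Omega) w * G w) * weight S w2 =
  expect mu (fun w => \1_(agree N w2 : set Omega) w * G w) * weight S w1.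
Proof.
move=> Hmu SW GW w12 N.
pose S' := (S `|` W)%fset; pose K := nbhd_fset (2 * r) S'; pose D := (K `\` N)%fset.
have SS' : {subset S <= S'} by move=> x xS; rewrite in_fsetU xS.
have NK x : x \in N -> x \in K.
  by move=> /nbhd_fsetP[y /SS' yS yx]; apply/nbhd_fsetP; exists y.
have ND : [disjoint N & D]%fset by rewrite fdisjoint_sym; apply: fdisjointDX.
have NDK : (N `|` D)%fset = K.
  apply/fsetP => x; rewrite in_fsetU in_fsetD; case: (boolP (x \in N)) => //= /NK.
  by move->.
have WK x : x \in W -> x \in K by move=> xW; rewrite sub_nbhd_fset// in_fsetU xW orbT.
have split_expect w : expect mu (fun y => \1_(agree N w : set Omega) y * G y)
    = \sum_(k : {ffun D -> A}) G (gluing k w) * fine (mu (agree K (gluing k w))).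
  transitivity (expect mu (fun y => \sum_(k : {ffun D -> A})
      G (gluing k w) * \1_(agree K (gluing k w) : set Omega) y)).
    congr expect; apply: funext => y.
    rewrite (@agree_split R V A a0 N D w y ND) NDK mulr_suml; apply: eq_bigr => k _.
    rewrite indicE; case: (boolP (y \in _)); rewrite ?mul0r ?mulr0// mul1r mulr1 inE => H.
    by apply: GW => x /WK; apply: H.
  rewrite expect_sum => [|k]; last exact/bounded_measurableZ/indic_agree_bounded.
  apply: eq_bigr => k _; rewrite expectZ; last exact: indic_agree_bounded.
  by rewrite expect_indic//; apply: agree_measurable.
rewrite !split_expect !mulr_suml; apply: eq_bigr => k _.
pose v1 := gluing k w1; pose v2 := gluing k w2.
have v12 x : x \notin S -> v1 x = v2 x.
  by move=> xS; rewrite /v1 /v2 /gluing; case: insubP => // _; apply: w12.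
have wv w : weight S (gluing k w) = weight S w.
  by apply: weight_depends => x xN; rewrite gluing_out// in_fsetD xN.
have -> : G (gluing k w1) = G (gluing k w2).
  apply: GW => x xW; apply: v12; move/fdisjointP: SW => SW.
  by apply/negP => /SW; rewrite xW.
rewrite -!mulrA; congr (_ * _); rewrite -(wv w1) -(wv w2) -/v1 -/v2.
have H1 := Hmu S' v1 v2; rewrite -/K in H1.
have {}H1 : fine (mu (agree K v1)) * weight S' v2 = fine (mu (agree K v2)) * weight S' v1.
  by apply: H1 => x xS; apply: v12; apply: contra xS; apply: SS'.
have H2 := weight_ratio SS' v12.
have W1 := weight_gt0 S' v1; have W2 := weight_gt0 S' v2.
apply: (mulfI (x := weight S' v1 * weight S' v2)); first by rewrite mulf_neq0// gt_eqF.
transitivity ((fine (mu (agree K v1)) * weight S' v2) * (weight S' v1 * weight S v2)); first by ring.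
by rewrite H1 H2; ring.
Qed.

End GibbsRatio.

(** * Automorphisms acting on configurations *)

(** A map into a product is continuous when its coordinates are. *)
Lemma reindex_continuous (I : choiceType) (T : topologicalType) (p : I -> I) :
  continuous ((fun w i => w (p i)) :
    prod_topology (fun _ : I => T) -> prod_topology (fun _ : I => T)).
Proof.
move=> w.
have Hw := @nbhs_filter _ w.
apply/cvg_sup => v.
have H : continuous ((fun f => f v) \o (fun w i => w (p i)) : prod_topology (fun _ : I => T) -> T).
  exact: (@proj_continuous I (fun=> T) (p v)).

move=> U [? /= [[W oW <-]] Wv /filterS]; apply; apply: (H w).
exact: open_nbhs_nbhs.
Qed.

Section Invariance.
Variables (R : realType) (V : choiceType) (E : rel V) (A : finType) (a0 : A).
Local Notation Omega := (borel_config V a0).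
Local Notation agree := (@agree V A a0).

Lemma act_measurable (g : graph_aut E) :
  measurable_fun setT (act g : Omega -> Omega).
Proof.
apply: (@measurability _ _ Omega Omega setT (act g) (@open_config V A a0)) => //.
move=> _ [B oB <-].
apply: sub_sigma_algebra; rewrite setTI.
have /continuousP H := @reindex_continuous V (discrete_topology A) (aut_inv g).
exact: (H B oB).
Qed.

Definition act_config (g : graph_aut E) : Omega -> Omega := act g.

HB.instance Definition _ (g : graph_aut E) :=
  isMeasurableFun.Build _ _ _ _ (act_config g) (act_measurable g).

Definition moved (nu : probability Omega R) (g : graph_aut E) : probability Omega R :=
  distribution nu (act_config g).

Lemma movedE nu g B : moved nu g B = nu (act g @^-1` B).
Proof. by []. Qed.

End Invariance.

(** * Invariance and decorrelation of the unique Gibbs measure *)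

Section UniqueGibbs.
Variables (R : realType) (d : nat) (V : choiceType) (E : rel V).
Hypothesis hT : regular_tree E d.
Variables (A : finType) (a0 : A) (psi : V -> (V -> A) -> R) (r : nat).
Hypothesis psi_range : has_range E r psi.
Hypothesis psi_sym : symmetric_family E psi.
Local Notation Omega := (borel_config V a0).
Local Notation dist := (gdist E).
Local Notation agree := (@agree V A a0).
Implicit Types (S K W : {fset V}) (w t : V -> A) (mu : probability Omega R).

Lemma prob_ratio_moved mu (g : graph_aut E) :
  prob_ratio E psi r mu -> prob_ratio E psi r (moved mu g).
Proof.
move=> Hmu S w1 w2 w12.
pose S' := [fset aut_inv g x | x in S]%fset.
have memS' y : (y \in S') = (g y \in S).
  apply/imfsetP/idP => [[x xS ->]|gy]; first by rewrite (aut_invK g).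
  by exists (g y) => //; rewrite (aut_funK g).
have memN n y : (y \in nbhd_fset E n S') = (g y \in nbhd_fset E n S).
  apply/(nbhd_fsetP hT)/(nbhd_fsetP hT) => -[x xS xy].
    by exists (g x); rewrite -?memS'// (aut_gdist hT).
  by exists (aut_inv g x); rewrite ?memS' ?(aut_invK g)// -(aut_gdist hT g) (aut_invK g).
pose w' w := fun v => w (g v) : A.
have preim w : act g @^-1` agree (nbhd_fset E (2 * r) S) w = agree (nbhd_fset E (2 * r) S') (w' w).
  apply/seteqP; split => y H x xN.
    by have := H (g x); rewrite /act (aut_funK g); apply; rewrite -memN.
  by rewrite /act H ?memN /w' ?(aut_invK g).
have weightE w : weight E psi r S w = weight E psi r S' (w' w).
  congr (expR (- _)); rewrite /energy.
  transitivity (\sum_(v <- map g (nbhd_fset E r S')) psi v w).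
    apply: perm_big; apply: uniq_perm; rewrite ?fset_uniq//.
      by rewrite map_inj_uniq ?fset_uniq//; apply: can_inj (aut_funK g).
    move=> v; apply/idP/mapP => [vN|[y + ->]]; last by rewrite memN.
    by exists (aut_inv g v); rewrite ?memN (aut_invK g).
  rewrite big_map; apply: eq_bigr => v _; rewrite -(psi_sym g v (w' w)); congr (psi _ _).
  by apply: funext => x; rewrite /act /w' (aut_invK g).
rewrite !movedE !preim !weightE; apply: Hmu => x xS; apply: w12.
by rewrite -memS'.
Qed.

Lemma expect_moved mu (g : graph_aut E) K (f : (V -> A) -> R) : depends_on K f ->
  expect (moved mu g) f = expect mu (fun w => f (act g w)).
Proof.
move=> fK; rewrite (expect_local _ (fun=> a0) fK).
pose B (k : {ffun K -> A}) := act g @^-1` agree K (gluing k (fun=> a0)) : set Omega.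
have mB k : measurable (B k).
  rewrite -[B k]setTI; apply: (@act_measurable V E A a0 g) => //.
  exact: agree_measurable.
transitivity (expect mu (fun w => \sum_(k : {ffun K -> A})
    f (gluing k (fun=> a0)) * \1_(B k) w)).
  rewrite expect_sum => [|k]; last exact/bounded_measurableZ/bounded_measurable_indic.
  apply: eq_bigr => k _; rewrite expectZ ?expect_indic//.
  exact: bounded_measurable_indic.
congr expect; apply: funext => w.
by rewrite (local_decomposition a0 (fun=> a0) fK).
Qed.

Variable nu : probability Omega R.
Hypothesis nu_unique : unique_gibbs E psi r nu.

Let nu_ratio : prob_ratio E psi r nu := gibbs_prob_ratio hT nu_unique.1.

Lemma nu_unique_ratio mu : prob_ratio E psi r mu -> forall B, measurable B -> mu B = nu B.
Proof. by move=> Hmu; apply: nu_unique.2; apply: (prob_ratio_gibbs hT). Qed.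

Lemma expect_act (g : graph_aut E) K (f : (V -> A) -> R) : depends_on K f ->
  expect nu (fun w => f (act g w)) = expect nu f.
Proof.
move=> fK; rewrite -(expect_moved nu g fK) !(expect_local _ (fun=> a0) fK).
apply: eq_bigr => k _; congr (_ * fine _); apply: nu_unique_ratio.
  exact: prob_ratio_moved.
exact: agree_measurable.
Qed.

Section Tilt.
Variables (o : V) (K : {fset V}) (F : (V -> A) -> R) (e : R).
Variables (W : nat -> {fset V}) (G : nat -> (V -> A) -> R).
Hypotheses (FK : depends_on K F) (e0 : 0 < e).
Hypotheses (GW : forall n, depends_on (W n) (G n))
  (Wfar : forall n x, x \in W n -> (n < dist o x)%N)
  (G1 : forall n w, `|G n w| <= 1) (covFG : forall n, e < cov nu F (G n)).

(** The factor 1 / 4 keeps the density between 1 / 2 and 3 / 2. *)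
Let density n w : R := 1 + (G n w - expect nu (G n)) / 4.

Let G_bounded n : bounded_measurable (G n : Omega -> R) :=
  local_bounded_measurable a0 (GW (n := n)).

Let density_depends n : depends_on (W n) (density n).
Proof. by move=> w w' H; rewrite /density (GW H). Qed.

Let density_bounded n : bounded_measurable (density n : Omega -> R) :=
  local_bounded_measurable a0 (density_depends (n := n)).

Let mean_le1 n : `|expect nu (G n)| <= 1.
Proof.
have m1 : bounded_measurable ((fun=> 1) : Omega -> R) by apply: bounded_measurable_cst.
have mN1 : bounded_measurable ((fun=> -1) : Omega -> R) by apply: bounded_measurable_cst.
have G1' w : - 1 <= G n w <= 1 by rewrite -ler_norml.
rewrite ler_norml -{1}(expect_cst nu (- 1)) -[X in _ && (_ <= X)](expect_cst nu 1).
by apply/andP; split; apply: expect_le => // w; have /andP[] := G1' w.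
Qed.

Let density_ge0 n w : 0 <= density n w.
Proof.
have := mean_le1 n; have := G1 n w; rewrite !ler_norml /density => /andP[] ? ? /andP[] ? ?.
lra.
Qed.

Let density_le2 n w : density n w <= 2.
Proof.
have := mean_le1 n; have := G1 n w; rewrite !ler_norml /density => /andP[] ? ? /andP[] ? ?.
lra.
Qed.

Let q n (B : set Omega) : R := expect nu (fun w => \1_B w * density n w).

Let qB_bounded n (B : set Omega) : measurable B ->
  bounded_measurable (fun w : Omega => \1_B w * density n w : R).
Proof. by move=> mB; apply: bounded_measurableM => //; apply: bounded_measurable_indic. Qed.

Let q_ge0 n B : measurable B -> 0 <= q n B.
Proof. by move=> mB; apply: expect_ge0 => w; rewrite mulr_ge0// indicE. Qed.

Let q_le n B : measurable B -> q n B <= 2 * fine (nu B).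
Proof.
move=> mB; have mI := bounded_measurable_indic R mB.
rewrite -expect_indic// -expectZ//; apply: expect_le.
- exact: qB_bounded.
- exact: bounded_measurableZ.
- by move=> w; rewrite mulrC ler_wpM2r// indicE.
Qed.

Let q_add n B C : measurable B -> measurable C -> B `&` C = set0 ->
  q n (B `|` C) = q n B + q n C.
Proof.
move=> mB mC BC; rewrite /q -expectD; [|exact: qB_bounded..].
congr expect; apply: funext => w; rewrite -mulrDl; congr (_ * _).
rewrite !indicE in_setU; case: (boolP (w \in B)) => wB; case: (boolP (w \in C)) => wC //=.
- suff : set0 w by []. by rewrite -BC; split; apply: set_mem.
- by rewrite addr0.
- by rewrite add0r.
- by rewrite addr0.
Qed.

Let expect_density n (f : Omega -> R) : bounded_measurable f ->
  expect nu (fun w => f w * density n w) = expect nu f + cov nu f (G n) / 4.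
Proof.
move=> mf; have mfG := bounded_measurableM mf (G_bounded n).
have -> : (fun w => f w * density n w) =
    (fun w => f w + (4^-1 * (f w * G n w) + (- (expect nu (G n) / 4)) * f w)).
  by apply: funext => w; rewrite /density; ring.
rewrite expectD//; last by apply: bounded_measurableD; apply: bounded_measurableZ.
rewrite expectD ?expectZ//; [|exact: bounded_measurableZ..].
by rewrite /cov; ring.
Qed.

Let qT n : q n setT = 1.
Proof.
have m1 : bounded_measurable ((fun=> 1) : Omega -> R) by apply: bounded_measurable_cst.
transitivity (expect nu (fun w => (fun=> 1) w * density n w)).
  by congr expect; apply: funext => w; rewrite indicE in_setT.
by rewrite expect_density// covC cov_cstr// mul0r addr0 expect_cst.
Qed.

(** The limit mu of the tilted measures is a Gibbs measure, since W n is eventually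
    disjoint from any given finite set.  But the mean of F under mu exceeds its mean
    under nu by at least e / 4. *)
Lemma tilt_contradiction : False.
Proof.
have [U [UU oU]] := @ultraFilterLemma nat \oo _.
have PU : ProperFilter U by apply: ultra_proper.
pose mu : probability Omega R := ultralimit_probability q_ge0 q_le q_add qT UU.
have mu_cvg B : measurable B -> q n B @[n --> U] --> fine (mu B).
  exact: ultralimit_probability_cvg.
have mu_ratio : prob_ratio E psi r mu.
  move=> S w1 w2 w12; set N := nbhd_fset E (2 * r) S.
  have c1 := mu_cvg _ (agree_measurable (a0 := a0) N w1).
  have c2 := mu_cvg _ (agree_measurable (a0 := a0) N w2).
  pose f n := q n (agree N w1) * weight E psi r S w2 - q n (agree N w2) * weight E psi r S w1.
  have cf : f n @[n --> U] --> fine (mu (agree N w1)) * weight E psi r S w2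
      - fine (mu (agree N w2)) * weight E psi r S w1.
    apply: cvgB; apply: cvgMl; last exact: c2.
    exact: c1.
  have cf0 : f n @[n --> U] --> (0 : R).
    apply: cvg_near_cst; apply: oU.
    (* From n0 on, the spins that G n depends on are outside S. *)
    pose n0 := \max_(x <- enum_fset S) dist o x.
    exists n0 => // n /= n0n; rewrite /f; apply/eqP; rewrite subr_eq0; apply/eqP.
    apply: (dlr_local hT psi_range nu_ratio _ (density_depends (n := n)) w12).
    apply/fdisjointP => x xS; apply/negP => /Wfar; rewrite ltnNge => /negP; apply.
    by apply: leq_trans n0n; apply: leq_bigmax_seq.
  by apply/eqP; rewrite -subr_eq0; apply/eqP; apply: norm_cvg_unique cf cf0.
pose c (k : {ffun K -> A}) := gluing k (fun=> a0) : V -> A.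
have muE k : fine (mu (agree K (c k))) = fine (nu (agree K (c k))).
  by rewrite (nu_unique_ratio mu_ratio)//; apply: agree_measurable.
have sum_cvg (s : seq {ffun K -> A}) :
    \sum_(k <- s) F (c k) * q n (agree K (c k)) @[n --> U] -->
    \sum_(k <- s) F (c k) * fine (nu (agree K (c k))).
  elim: s => [|k s IH].
    by rewrite big_nil; under eq_fun do rewrite big_nil; apply: cvg_cst.
  rewrite big_cons; under eq_fun do rewrite big_cons.
  apply: cvgD; last exact: IH.
  rewrite -muE; apply: cvgM; first exact: cvg_cst.
  exact: mu_cvg (agree_measurable K (c k)).
have := sum_cvg (index_enum _); rewrite -(expect_local nu (fun=> a0) FK) => H.
have : expect nu F + e / 4 <= expect nu F.
  rewrite -[X in _ <= X](cvg_lim (@norm_hausdorff _ _) H); apply: limr_ge.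
    by apply/cvg_ex; exists (expect nu F).
  apply: nearW => n.
  have -> : \sum_(k : {ffun K -> A}) F (c k) * q n (agree K (c k))
      = expect nu (fun w => F w * density n w).
    transitivity (expect nu (fun w => \sum_(k : {ffun K -> A})
        F (c k) * (\1_(agree K (c k) : set Omega) w * density n w))).
      rewrite expect_sum => [|k].
        by apply: eq_bigr => k _; rewrite expectZ//; apply: qB_bounded; apply: agree_measurable.
      by apply: bounded_measurableZ; apply: qB_bounded; apply: agree_measurable.
    congr expect; apply: funext => w.
    rewrite [F w](local_decomposition a0 (fun=> a0) FK) mulr_suml.
    by apply: eq_bigr => k _; rewrite mulrA.
  rewrite expect_density; last exact: local_bounded_measurable FK.
  by have := covFG n; lra.
by have := e0; lra.
Qed.

End Tilt.

(** Otherwise there are functions G n, bounded by 1, of spins at distance more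
    than n, whose covariances with F are larger than e; this contradicts
    [tilt_contradiction]. *)
Lemma tail_decorrelation o K (F : (V -> A) -> R) e : depends_on K F -> 0 < e ->
  exists n, forall W (G : (V -> A) -> R), depends_on W G ->
    (forall x, x \in W -> (n < dist o x)%N) -> (forall w, `|G w| <= 1) ->
    `|cov nu F G| <= e.
Proof.
move=> FK e0; apply: contrapT => H.
have {}H n : exists p : {fset V} * ((V -> A) -> R),
    [/\ depends_on p.1 p.2, forall x, x \in p.1 -> (n < dist o x)%N,
        forall w, `|p.2 w| <= 1 & e < cov nu F p.2].
  apply: contrapT => Hn; apply: H; exists n => W G GW Wfar G1.
  rewrite leNgt; apply/negP => eFG; apply: Hn.
  have FM := local_bounded_measurable a0 FK.
  have GM := local_bounded_measurable a0 GW.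
  have [G0|G0] := lerP 0 (cov nu F G).
    by exists (W, G); split => //=; rewrite ger0_norm in eFG.
  exists (W, fun w => -1 * G w); split => //=.
  - by move=> w w' /GW ->.
  - by move=> w; rewrite normrM normrN normr1 mul1r.
  - by rewrite (covZr nu _ FM GM) mulN1r; rewrite ltr0_norm in eFG.
have [p Hp] := choice H.
apply: (@tilt_contradiction o K F e (fun n => (p n).1) (fun n => (p n).2)) => // n.
- by have [] := Hp n.
- by have [] := Hp n.
- by have [] := Hp n.
- by have [] := Hp n.
Qed.

(** Truncate G at height L = M / e, where M bounds the centred F.  The bounded part
    is covered by [tail_decorrelation]; the rest is at most g^2 / L in absolute value,
    where g is the centred G. *)
Theorem decorrelation o K (F : (V -> A) -> R) e : depends_on K F -> 0 < e ->
  exists n, forall W (G : (V -> A) -> R), depends_on W G ->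
    (forall x, x \in W -> (n < dist o x)%N) ->
    cov nu F G <= e * (1 + cov nu G G).
Proof.
move=> FK e0; have FM := local_bounded_measurable a0 FK.
have [M0 HM0] := FM.2; pose M := `|M0| + `|expect nu F| + 1.
have M1 : 0 < M by rewrite /M ltr_pwDr// addr_ge0.
have FB w : `|F w - expect nu F| <= M.
  apply: (le_trans (ler_normB _ _)); rewrite /M.
  have := HM0 w; have := ler_norm M0; lra.
(* Both parts of the estimate then carry the factor e. *)
pose L := M / e; have L0 : 0 < L by rewrite divr_gt0.
have [n Hn] := tail_decorrelation o FK (divr_gt0 e0 L0).
exists n => W G GW Wfar.
pose g w := G w - expect nu G.
have gW : depends_on W g by move=> w w' H; rewrite /g (GW _ _ H).
pose h w := if `|g w| <= L then g w / L else 0.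
have hW : depends_on W h by move=> w w' H; rewrite /h (gW _ _ H).
have GM := local_bounded_measurable a0 GW.
have gM := local_bounded_measurable a0 gW.
have hM := local_bounded_measurable a0 hW.
have h1 w : `|h w| <= 1.
  rewrite /h; case: ifP => H; last by rewrite normr0.
  by rewrite normrM normfV (gtr0_norm L0) ler_pdivrMr// mul1r.
have Hh : cov nu F h <= e / L by apply: le_trans (ler_norm _) (Hn W h hW Wfar h1).
have mc c : bounded_measurable ((fun=> c) : Omega -> R) by apply: bounded_measurable_cst.
have covg f : bounded_measurable (f : Omega -> R) -> cov nu f g = cov nu f G.
  move=> fM; rewrite /g covDr// cov_cstr// addr0.
  done.
have gg : cov nu G G = expect nu (fun w => g w ^+ 2).
  by rewrite -covg// cov_expect.
pose k w := g w - L * h w.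
have kM : bounded_measurable (k : Omega -> R).
  have -> : k = fun w => g w + (- L) * h w by apply: funext => w; rewrite /k mulNr.
  by apply: bounded_measurableD => //; apply: bounded_measurableZ.
have kg w : `|k w| <= g w ^+ 2 / L.
  rewrite /k /h; case: ifPn => [_|].
    by rewrite mulrCA divff ?gt_eqF// mulr1 subrr normr0 divr_ge0 ?sqr_ge0// ltW.
  rewrite -ltNge mulr0 subr0 => Lg; rewrite ler_pdivlMr// -real_normK ?num_real//.
  by rewrite expr2 ler_wpM2l// ltW.
have covk : cov nu F k <= M / L * cov nu G G.
  rewrite gg -expectZ; last first.
    exact: (bounded_measurableM gM gM).
  rewrite cov_expect//; apply: expect_le.
  - apply: bounded_measurableM => //; apply: bounded_measurableD => //.
  - by apply: bounded_measurableZ; apply: (bounded_measurableM gM gM).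
  move=> w; apply: (le_trans (ler_norm _)); rewrite normrM -mulrA [L^-1 * _]mulrC.
  exact: ler_pM.
have -> : cov nu F G = L * cov nu F h + cov nu F k.
  rewrite -covg// -covZr// -covDr//; last exact: bounded_measurableZ.
  by congr cov; apply: funext => w; rewrite /k addrC subrK.
have -> : e * (1 + cov nu G G) = L * (e / L) + M / L * cov nu G G.
  by rewrite /L; field; rewrite !gt_eqF.
by apply: lerD => //; apply: ler_wpM2l => //; apply: ltW.
Qed.

End UniqueGibbs.

(** * Averaging operators on symmetric observables *)

Section Families.
Variables (R : realType) (d : nat) (V : choiceType) (E : rel V).
Hypothesis hT : regular_tree E d.
Hypothesis hd : (2 < d)%N.
Variables (A : finType) (a0 : A) (psi : V -> (V -> A) -> R) (r : nat).
Hypothesis psi_range : has_range E r psi.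
Hypothesis psi_sym : symmetric_family E psi.
Local Notation Omega := (borel_config V a0).
Local Notation dist := (gdist E).
Variable nu : probability Omega R.
Hypothesis nu_unique : unique_gibbs E psi r nu.
Local Notation cov := (cov nu).
Implicit Types (F G : V -> (V -> A) -> R) (p q : {poly R}).

Definition ball_fset v n : {fset V} := [fset y in ball_seq E v n]%fset.

Lemma mem_ball_fset v n y : (y \in ball_fset v n) = (dist v y <= n)%N.
Proof. by rewrite inE (mem_ball_seq hT). Qed.

(** Symmetric families with a common range. *)
Definition observable F :=
  symmetric_family E F /\ exists D, forall v, depends_on (ball_fset v D) (F v).

(** By transitivity a range at one vertex is a range at all vertices. *)
Lemma local_observable F : local E F -> symmetric_family E F -> observable F.
Proof.
move=> Floc Fsym; split=> //; have [ o _] := rt_nonempty hT.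
have [D _ FD] := Floc o; exists D => v w w' ww'.
have [g [gv _]] : exists g : graph_aut E, g o = v /\ g o = v.
  by apply: (two_point_homogeneous hT); rewrite !gdistxx.
have FvE u : F v u = F o (fun x => u (g x)).
  rewrite -gv -(Fsym g o); congr (F _ _); apply: funext => x.
  by rewrite /act (aut_invK g).
rewrite !FvE; apply: factors_throughP FD _ => x ox; apply: ww'.
by rewrite mem_ball_fset -gv (aut_gdist hT).
Qed.

Lemma observable_bounded F v : observable F -> bounded_measurable (F v : Omega -> R).
Proof. by move=> [_ [D /(_ v)]]; apply: local_bounded_measurable. Qed.

(** Automorphisms preserve nu and act transitively on pairs at given distance. *)
Lemma cov_invariant F G u v x y : observable F -> observable G ->
  dist u v = dist x y -> cov (F u) (G v) = cov (F x) (G y).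
Proof.
move=> [Fs [D FD]] [Gs [D' GD]] /(two_point_homogeneous hT)[g [<- <-]].
have Fg z w : F (g z) (act g w) = F z w by apply: Fs.
have Gg z w : G (g z) (act g w) = G z w by apply: Gs.
have inv := expect_act hT psi_sym nu_unique g.
pose K := (ball_fset (g u) D `|` ball_fset (g v) D')%fset.
have FK : depends_on K (F (g u)).
  by move=> w w' H; apply: FD => z zB; apply: H; rewrite in_fsetU zB.
have GK : depends_on K (G (g v)).
  by move=> w w' H; apply: GD => z zB; apply: H; rewrite in_fsetU zB orbT.
have FGK : depends_on K (fun w => F (g u) w * G (g v) w).
  by move=> w w' H; rewrite (FK _ _ H) (GK _ _ H).
rewrite !covE -(inv _ _ FK) -(inv _ _ GK) -(inv _ _ FGK).
congr (_ - _ * _); congr expect; apply: funext => w; by rewrite ?Fg ?Gg.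
Qed.

Definition avg F : V -> (V -> A) -> R :=
  fun v w => d%:R^-1 * \sum_(u <- nbrs E v) F u w.

Lemma avg_observable F : observable F -> observable (avg F).
Proof.
move=> [Fs [D FD]]; split.
  move=> g v w; rewrite /avg; congr (_ * _).
  transitivity (\sum_(u <- map g (nbrs E v)) F u (act g w)).
    apply: perm_big; apply: uniq_perm; rewrite ?uniq_nbrs//.
      by rewrite map_inj_uniq ?uniq_nbrs//; apply: can_inj (aut_funK g).
    move=> u; rewrite (mem_nbrs hT); apply/idP/mapP => [gu|[x + ->]].
      exists (aut_inv g u); rewrite ?(aut_invK g)// (mem_nbrs hT).
      by rewrite -(aut_edge g) (aut_invK g).
    by rewrite (mem_nbrs hT) aut_edge.
  by rewrite big_map; apply: eq_bigr => u _; apply: Fs.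
exists D.+1 => v w w' ww'; rewrite /avg; congr (_ * _).
rewrite big_seq [RHS]big_seq; apply: eq_bigr => u; rewrite (mem_nbrs hT) => vu.
apply: FD => x; rewrite mem_ball_fset => ux; apply: ww'; rewrite mem_ball_fset.
by have := gdist_triangle hT u v x; rewrite (gdist_edge hT vu); lia.
Qed.

Lemma degree_gt0 : 0 < d%:R :> R. Proof. by rewrite ltr0n; lia. Qed.

Lemma cov_avgr F G v : observable F -> observable G ->
  cov (F v) (avg G v) = d%:R^-1 * \sum_(u <- nbrs E v) cov (F v) (G u).
Proof.
move=> oF oG; have bG u := observable_bounded u oG.
rewrite covZr; [|exact: observable_bounded|exact: bounded_measurable_sum].
by congr (_ * _); rewrite cov_sumr//; apply: observable_bounded.
Qed.

(** For neighbours u and v the covariances of F u with G v and of F v with G u are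
    equal, as an automorphism exchanges u and v. *)
Lemma cov_avg_adjoint F G v : observable F -> observable G ->
  cov (avg F v) (G v) = cov (F v) (avg G v).
Proof.
move=> oF oG; rewrite covC !cov_avgr//; congr (_ * _).
apply: eq_bigr => u _; rewrite covC; apply: cov_invariant => //.
exact: gdist_sym hT _ _.
Qed.

Lemma var_avg_le F v : observable F -> cov (avg F v) (avg F v) <= cov (F v) (F v).
Proof.
move=> oF; have oA := avg_observable oF.
have var0 : 0 <= cov (F v) (F v) by apply/var_ge0/observable_bounded.
have cov_le u x : cov (F u) (F x) <= cov (F v) (F v).
  apply: ler_of_sqr => //.
  have := cov_CS nu (observable_bounded u oF) (observable_bounded x oF).
  have varE z : cov (F z) (F z) = cov (F v) (F v).
    by apply: cov_invariant; rewrite ?gdistxx.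
  by rewrite !varE -expr2.
have avg_le (f : V -> R) : (forall u, f u <= cov (F v) (F v)) ->
    d%:R^-1 * \sum_(u <- nbrs E v) f u <= cov (F v) (F v).
  move=> fle; rewrite mulrC ler_pdivrMr ?degree_gt0//.
  have <- : \sum_(u <- nbrs E v) cov (F v) (F v) = cov (F v) (F v) * d%:R.
    by rewrite big_const_seq count_predT iter_addr_0 (size_nbrs hT) mulr_natr.
  exact: ler_sum.
rewrite (cov_avgr v oA oF); apply: (avg_le _) => u.
have bF z := observable_bounded z oF.
rewrite covC covZr//; last exact: bounded_measurable_sum.
by rewrite cov_sumr//; apply: avg_le.
Qed.

(** The polynomial p evaluated at the operator [avg], applied to F. *)
Definition poly_avg p F : V -> (V -> A) -> R :=
  fun v w => moments (fun i => iter i avg F v w) p.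

Lemma iter_avg_observable i F : observable F -> observable (iter i avg F).
Proof. by elim: i F => //= i IH F /IH/avg_observable. Qed.

Lemma observable_comb F G a b : observable F -> observable G ->
  observable (fun v w => a * F v w + b * G v w).
Proof.
move=> [Fs [D FD]] [Gs [D' GD]]; split => [g v w|]; first by rewrite Fs Gs.
exists (maxn D D') => v w w' H; congr (_ * _ + _ * _).
  by apply: FD => x; rewrite mem_ball_fset => xD; apply: H; rewrite mem_ball_fset leq_max xD.
by apply: GD => x; rewrite mem_ball_fset => xD; apply: H; rewrite mem_ball_fset leq_max xD orbT.
Qed.

Lemma poly_avgX p F : poly_avg ('X * p) F = avg (poly_avg p F).
Proof.
apply: funext => v; apply: funext => w; rewrite /poly_avg momentsX /avg /moments /=.
rewrite exchange_big /= mulr_sumr; apply: eq_bigr => i _.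
by rewrite mulrCA; congr (_ * _); rewrite mulr_sumr.
Qed.

Lemma poly_avg_comb p q F a b :
  poly_avg (a *: p + b *: q) F = fun v w => a * poly_avg p F v w + b * poly_avg q F v w.
Proof.
by apply: funext => v; apply: funext => w; rewrite /poly_avg momentsD !momentsZ.
Qed.

Lemma poly_avg1 F : poly_avg 1 F = F.
Proof. by apply: funext => v; apply: funext => w; rewrite /poly_avg moments1. Qed.

Lemma poly_avg_MXaddC p c F :
  poly_avg (p * 'X + c%:P) F = fun v w => 1 * avg (poly_avg p F) v w + c * F v w.
Proof.
have -> : p * 'X + c%:P = 1 *: ('X * p) + c *: 1 by rewrite scale1r alg_polyC mulrC.
by rewrite poly_avg_comb poly_avgX poly_avg1.
Qed.

Lemma poly_avg_observable p F : observable F -> observable (poly_avg p F).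
Proof.
move=> oF; elim/poly_ind: p => [|p c IH].
  have -> : poly_avg 0 F = fun v w => 0 * F v w + 0 * F v w.
    by apply: funext => v; apply: funext => w; rewrite /poly_avg moments0 mul0r addr0.
  exact: observable_comb.
by rewrite poly_avg_MXaddC; apply: observable_comb => //; apply: avg_observable.
Qed.

Definition cov_moment F o i : R := cov (F o) (iter i avg F o).

Lemma moments_cov F o p : observable F ->
  moments (cov_moment F o) p = cov (F o) (poly_avg p F o).
Proof.
move=> oF; rewrite /poly_avg /moments cov_sumr => [||i].
- apply: eq_bigr => i _; rewrite covZr//; first exact: observable_bounded.
  by apply: observable_bounded; apply: iter_avg_observable.
- exact: observable_bounded.
- by apply: bounded_measurableZ; apply: observable_bounded; apply: iter_avg_observable.
Qed.

Lemma cov_comb F G H a b o : observable F -> observable G -> observable H ->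
  cov (fun w => a * F o w + b * G o w) (H o) = a * cov (F o) (H o) + b * cov (G o) (H o).
Proof.
move=> oF oG oH; have bF := observable_bounded o oF; have bG := observable_bounded o oG.
have bH := observable_bounded o oH.
rewrite covC covDr//; [|exact: bounded_measurableZ..].
by rewrite !covZr// (covC nu (H o) (F o)) (covC nu (H o) (G o)).
Qed.

Lemma cov_poly_avg F o p q : observable F ->
  cov (poly_avg p F o) (poly_avg q F o) = moments (cov_moment F o) (p * q).
Proof.
move=> oF; elim/poly_ind: p q => [|p c IH] q.
  have -> : poly_avg 0 F = fun v w => 0 * F v w + 0 * F v w.
    by apply: funext => v; apply: funext => w; rewrite /poly_avg moments0 mul0r addr0.
  by rewrite cov_comb ?mul0r ?moments0 ?addr0//; apply: poly_avg_observable.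
have oq := poly_avg_observable q oF; have op := poly_avg_observable p oF.
rewrite poly_avg_MXaddC cov_comb//; last exact: avg_observable.
rewrite mul1r cov_avg_adjoint// -poly_avgX IH.
have -> : (p * 'X + c%:P) * q = p * ('X * q) + c *: q.
  by rewrite mulrDl mul_polyC mulrA.
by rewrite momentsD momentsZ (moments_cov o q oF).
Qed.

Lemma sqnorm_cov F o p : observable F ->
  sqnorm (cov_moment F o) p = cov (poly_avg p F o) (poly_avg p F o).
Proof. by move=> oF; rewrite cov_poly_avg. Qed.

Lemma cov_moment_positive F o : observable F -> positive_moments (cov_moment F o).
Proof.
move=> oF p; rewrite sqnorm_cov//.
by apply/var_ge0/observable_bounded/poly_avg_observable.
Qed.

Lemma cov_moment_contraction F o p : observable F ->
  sqnorm (cov_moment F o) ('X * p) <= sqnorm (cov_moment F o) p.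
Proof.
move=> oF; rewrite !sqnorm_cov// poly_avgX.
exact/var_avg_le/poly_avg_observable.
Qed.

Definition sphere_sum k F : V -> (V -> A) -> R :=
  fun v w => \sum_(x <- sphere E v k) F x w.

Let b : R := d%:R - 1.

Let bD : b + 1 = d%:R. Proof. by rewrite /b subrK. Qed.

Let dE : d.-1%:R = b.
Proof. by rewrite /b -[in RHS](@prednK d) -?natr1 ?addrK//; lia. Qed.

Let b2 : 2 <= b.
Proof. by rewrite -dE ler_nat; lia. Qed.

Lemma sphere_sum_step F v w k :
  \sum_(u <- nbrs E v) sphere_sum k.+1 F u w =
  sphere_sum k.+2 F v w + (if k is 0 then b + 1 else b) * sphere_sum k F v w.
Proof.
rewrite /sphere_sum (sum_neighbor_spheres hT); congr (_ + _).
by case: k => [|k]; rewrite -mulr_natl ?dE ?bD.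
Qed.

Lemma sphere_sum0 F v w : sphere_sum 0 F v w = F v w.
Proof. by rewrite /sphere_sum sphere0 big_seq1. Qed.

Lemma sphere_sum1 F v w : sphere_sum 1 F v w = \sum_(u <- nbrs E v) F u w.
Proof. exact: perm_big (perm_sphere1 hT v). Qed.

Lemma poly_avg_spherical k F : poly_avg (spherical b k) F = sphere_sum k F.
Proof.
have dn0 : d%:R != 0 :> R by rewrite gt_eqF// degree_gt0.
have davg G : (fun v w => d%:R * avg G v w) = fun v w => \sum_(u <- nbrs E v) G u w.
  by apply: funext => v; apply: funext => w; rewrite /avg mulrA divff// mul1r.
elim: k {-2}k (leqnn k) => [|m IH] [|[|k]] // km.
1,2: by rewrite poly_avg1; apply: funext => v; apply: funext => w; rewrite sphere_sum0.
- have -> : spherical b 1 = d%:R *: ('X * 1) + 0 *: 1 by rewrite mulr1 scale0r addr0 -bD.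
  rewrite poly_avg_comb poly_avgX poly_avg1.
  apply: funext => v; apply: funext => w.
  by rewrite mul0r addr0 -[LHS]/((fun v w => d%:R * avg F v w) v w) davg sphere_sum1.
have -> : spherical b k.+2 = d%:R *: ('X * spherical b k.+1)
    + (- (if k is 0 then b + 1 else b)) *: spherical b k by rewrite scaleNr -bD.
rewrite poly_avg_comb poly_avgX (IH k.+1)// (IH k); last by lia.
apply: funext => v; apply: funext => w.
rewrite -[d%:R * _]/((fun v w => d%:R * avg (sphere_sum k.+1 F) v w) v w) davg.
by rewrite sphere_sum_step mulNr addrK.
Qed.

(** Both sides satisfy the recurrence of the random walk; the boundary terms of the
    summation by parts vanish since i steps do not reach distance n. *)
Lemma iter_avg_radial F i n v w : (i < n)%N ->
  iter i avg F v w = \sum_(j < n) radial_walk b i j * sphere_sum j F v w.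
Proof.
have D0 := degree_gt0; have Dn0 : d%:R != 0 :> R by rewrite gt_eqF.
elim: i n v => [|i IH] [//|n] v ni.
  rewrite big_ord_recl big1 ?addr0 /= ?mul1r ?sphere_sum0// => j _.
  by rewrite mul0r.
pose a := radial_walk b i; pose s j := sphere_sum j F v w.
pose T j := d%:R^-1 * \sum_(u <- nbrs E v) sphere_sum j F u w.
(* Summation by parts, with the two boundary terms made explicit. *)
have H m : \sum_(j < m.+1) a j * T j = \sum_(j < m.+1) radial_step b a j * s j
    + d%:R^-1 * a m * s m.+1 - (if m is 0 then 1 else b / d%:R) * a m.+1 * s m.
  elim: m => [|m IHm].
    rewrite !big_ord1 /= /T; under eq_bigr do rewrite sphere_sum0.
    by rewrite -sphere_sum1 -/(s 1%N); ring.
  rewrite big_ord_recr [X in _ = X + _ - _]big_ord_recr /= IHm.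
  rewrite /T sphere_sum_step -/(s m.+2) -/(s m) bD.
  by case: (m) => [|l]; field.
have an : a n = 0 by apply: radial_walk_support.
have an1 : a n.+1 = 0 by apply: radial_walk_support; apply: leqW.
transitivity (\sum_(j < n.+1) a j * T j); last first.
  by rewrite H an an1 !mulr0 !mul0r addr0 subr0.
transitivity (d%:R^-1 * \sum_(u <- nbrs E v) iter i avg F u w) => //.
under eq_bigr do rewrite (IH n.+1) ?ltnS 1?ltnW//.
rewrite exchange_big /= mulr_sumr; apply: eq_bigr => j _.
by rewrite /T -mulr_sumr mulrCA.
Qed.

Lemma poly_avg_radial F p n v w : (size p <= n)%N ->
  poly_avg p F v w = \sum_(j < n) radial_coef b p j * sphere_sum j F v w.
Proof.
move=> pn; rewrite /poly_avg /moments.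
transitivity (\sum_(i < size p) \sum_(j < n) p`_i * (radial_walk b i j * sphere_sum j F v w)).
  apply: eq_bigr => i _; rewrite (@iter_avg_radial F i n) ?mulr_sumr//.
  exact: leq_trans (ltn_ord i) pn.
rewrite exchange_big /=; apply: eq_bigr => j _.
by rewrite /radial_coef /moments mulr_suml; apply: eq_bigr => i _; rewrite mulrA.
Qed.

(** Split p into the part low carried by the spheres of radius at most m and the
    rest.  The first is estimated by Cauchy-Schwarz and [radial_coef_le], the second is
    a function of spins at distance more than n from o, to which [decorrelation]
    applies. *)
Lemma sphere_decoupling F o e : observable F -> 0 < e ->
  exists2 K, 0 <= K & forall p, moments (cov_moment F o) p
    <= e * (1 + sqnorm (cov_moment F o) p) + K * sqnorm (tree_moment b) p.
Proof.
move=> oF e0; have [Fs [D FD]] := oF.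
set x := cov_moment F o; have xpos : positive_moments x by apply: cov_moment_positive.
have e2 : 0 < e / 2 by rewrite divr_gt0.
have [n Hn] := decorrelation hT psi_range nu_unique o (FD o) e2.
pose m := (n + D)%N; pose Q := \sum_(j < m.+1) sqnorm x (spherical b j).
have Q0 : 0 <= Q by apply: sumr_ge0 => j _; apply: xpos.
pose Q' := m.+1%:R ^+ 2 * Q; have Q'0 : 0 <= Q' by rewrite mulr_ge0// sqr_ge0.
have N1 : 0 <= sqnorm x 1 by apply: xpos.
exists (sqnorm x 1 * Q' / (e / 2) + e * Q').
  by rewrite addr_ge0 ?mulr_ge0 ?invr_ge0 ?(ltW e2) ?(ltW e0).
move=> p; set t := sqnorm (tree_moment b) p.
have t0 : 0 <= t by apply: tree_moment_positive.
pose low : {poly R} := \sum_(j < m.+1) radial_coef b p j *: spherical b j.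
have low_le : sqnorm x low <= Q' * t.
  pose f j := if (j < m.+1)%N then radial_coef b p j *: spherical b j else 0.
  have -> : low = \sum_(j < m.+1) f j.
    by apply: eq_bigr => j _; rewrite /f ltn_ord.
  rewrite /Q' -mulrA; apply: sqnorm_sum_le => // j; rewrite /f; case: ifP => jm; last first.
    by rewrite /sqnorm expr0n /= moments0 mulr_ge0.
  rewrite sqnormZ mulrC; apply: ler_pM; rewrite ?sqr_ge0 ?xpos//; last exact: radial_coef_le.
  rewrite /Q (bigD1 (Ordinal jm)) //= lerDl; apply: sumr_ge0 => i _; exact: xpos.
have Lp : moments x p = moments x low + moments x (p - low) by rewrite momentsB addrC subrK.
have Llow : moments x low <= e / 2 + sqnorm x 1 * Q' / (e / 2) * t.
  have := moments_CS xpos 1 low; rewrite mul1r => H1.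
  have H2 : moments x low ^+ 2 <= sqnorm x 1 * (Q' * t).
    by apply: (le_trans H1); apply: ler_wpM2l.
  have -> : sqnorm x 1 * Q' / (e / 2) * t = sqnorm x 1 * (Q' * t) / (e / 2).
    by field; rewrite gt_eqF.
  rewrite -lerBlDl ler_pdivlMr//.
  have := sqr_ge0 (moments x low - e / 2); move: H2; move: (moments x low) => l; nra.
have Lhigh : moments x (p - low) <= e / 2 * (1 + sqnorm x (p - low)).
  pose N0 := maxn (size p) m.+1.
  (* All spins that the spheres with m < j < N0 depend on. *)
  pose W := [fset y in [seq y <- ball_seq E o (N0 + D) | (n < dist o y)%N]]%fset.
  pose G w := \sum_(j < N0 | (m < j)%N) radial_coef b p j * sphere_sum j F o w.
  have GE : poly_avg (p - low) F o = G.
    apply: funext => w.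
    have -> : poly_avg (p - low) F o w = poly_avg p F o w - poly_avg low F o w.
      by rewrite /poly_avg momentsB.
    rewrite (@poly_avg_radial F p N0 o w (leq_maxl (size p) m.+1)).
    have -> : poly_avg low F o w = \sum_(j < m.+1) radial_coef b p j * sphere_sum j F o w.
      rewrite /low; elim: (m.+1) => [|l IHl].
        by rewrite !big_ord0 /poly_avg moments0.
      rewrite !big_ord_recr /= -IHl -[X in _ = _ + _ * X o w]poly_avg_spherical.
      by rewrite /poly_avg momentsD momentsZ.
    rewrite [X in _ - X](big_ord_widen N0 (fun j => radial_coef b p j * sphere_sum j F o w)) ?leq_maxr//.
    rewrite (bigID (fun j : 'I_N0 => (m < j)%N)) /= -/(G w) -addrA.
    rewrite [X in _ + X](_ : _ = 0) ?addr0//.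
    apply/eqP; rewrite subr_eq0; apply/eqP; apply: eq_bigl => j.
    by rewrite -leqNgt ltnS.
  have GW : depends_on W G.
    move=> w w' H; apply: eq_bigr => j mj; congr (_ * _).
    rewrite /sphere_sum big_seq [RHS]big_seq; apply: eq_bigr => y.
    rewrite (mem_sphere hT) => /eqP oy; apply: FD => z; rewrite mem_ball_fset => yz.
    apply: H; rewrite inE mem_filter (mem_ball_seq hT).
    have h1 := gdist_triangle hT y o z; have h2 := gdist_triangle hT z o y.
    rewrite (gdist_sym hT z y) in h2.
    have jN := ltn_ord j; move: mj; rewrite /m => mj.
    by apply/andP; split; lia.
  rewrite (moments_cov o (p - low) oF) sqnorm_cov// GE; apply: (Hn W) => // y.
  by rewrite inE mem_filter => /andP[].
have Nhigh : sqnorm x (p - low) <= 2 * sqnorm x p + 2 * (Q' * t).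
  by apply: (le_trans (sqnormB_le xpos p low)); rewrite lerD2l ler_pM2l.
rewrite Lp.
have H3 : e / 2 * (1 + sqnorm x (p - low)) <= e / 2 * (1 + (2 * sqnorm x p + 2 * (Q' * t))).
  by apply: ler_wpM2l; [exact: ltW|rewrite lerD2l].
lra.
Qed.

Lemma tree_ratio_lt1 : 4 * b / (b + 1) ^+ 2 < 1.
Proof.
have b2' := b2; rewrite ltr_pdivrMr ?mul1r; last by rewrite exprn_gt0//; lra.
have : 0 < (b - 1) ^+ 2 by rewrite exprn_gt0//; lra.
lra.
Qed.

(** [spectral_transfer] for the family p(A) F in place of F. *)
Lemma cov_moment_tempered F o p : observable F ->
  sqnorm (cov_moment F o) ('X * p) <= 4 * b / (b + 1) ^+ 2 * sqnorm (cov_moment F o) p.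
Proof.
move=> oF; have oG := poly_avg_observable p oF.
have b0 : 0 < b by apply: lt_le_trans b2.
have r0 : 0 <= 4 * b / (b + 1) ^+ 2.
  by rewrite divr_ge0 ?sqr_ge0// mulr_ge0// ltW.
have := spectral_transfer (cov_moment_positive o oG) (tree_moment_positive b2) r0
  tree_ratio_lt1 (fun q => cov_moment_contraction o q oG) (tree_sqnormX_le b2)
  (fun e e0 => sphere_decoupling o oG e0).
by rewrite -[X in sqnorm _ X]mulr1 !sqnorm_cov// !poly_avgX !poly_avg1.
Qed.

Lemma size_sphere_ge v k : b ^+ k <= (size (sphere E v k))%:R.
Proof.
case: k => [|k]; first by rewrite sphere0.
rewrite (size_sphere hT); last by lia.
rewrite natrM natrX dE exprS ler_wpM2r ?exprn_ge0 -?dE ?ler_nat ?leq_pred//.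
Qed.

Lemma cov_sphere F u v o : observable F ->
  (size (sphere E o (dist u v)))%:R * cov (F u) (F v)
  = cov (F o) (sphere_sum (dist u v) F o).
Proof.
move=> oF; rewrite cov_sumr => [||x]; try exact: observable_bounded.
rewrite big_seq.
under eq_bigr => x xs.
  rewrite (@cov_invariant F F o x u v)//; last by apply/eqP; rewrite -(mem_sphere hT).
  over.
by rewrite -big_seq big_const_seq count_predT iter_addr_0 mulr_natl.
Qed.

(** The covariance with one vertex is that with the whole sphere divided by its
    size, and the latter is bounded by Cauchy-Schwarz and [spherical_growth]. *)
Theorem cov_sqrt_decay F : observable F -> exists2 C, 0 <= C & forall u v,
  cov (F u) (F v) * Num.sqrt b ^+ dist u v <= C * (dist u v).+1%:R.
Proof.
move=> oF; have [ o _] := rt_nonempty hT.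
have b0 : 0 < b by apply: lt_le_trans b2.
have pos := cov_moment_positive o oF.
have [K K0 HK] := spherical_growth b2 pos (fun p => cov_moment_tempered o p oF).
set x := cov_moment F o in pos HK.
exists (Num.sqrt (sqnorm x 1) * K); first by rewrite mulr_ge0 ?sqrtr_ge0.
move=> u v; set k := dist u v; set c := cov (F u) (F v).
have sb0 : 0 < Num.sqrt b ^+ k by rewrite exprn_gt0// sqrtr_gt0.
have [c0|c0] := lerP c 0.
  apply: (@le_trans _ _ 0); first by rewrite pmulr_lle0.
  by rewrite !mulr_ge0 ?sqrtr_ge0.
have H1 : b ^+ k * c <= Num.sqrt (sqnorm x 1) * Num.sqrt (sqnorm x (spherical b k)).
  apply: (@le_trans _ _ ((size (sphere E o k))%:R * c)).
    by apply: ler_wpM2r; [exact: ltW|exact: size_sphere_ge].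
  rewrite cov_sphere//; apply: ler_of_sqr; first by rewrite mulr_ge0 ?sqrtr_ge0.
  rewrite exprMn !sqr_sqrtr ?pos// !sqnorm_cov// poly_avg1 poly_avg_spherical.
  apply: cov_CS; first exact: observable_bounded.
  by apply: bounded_measurable_sum => y; apply: observable_bounded.
have H2 : b ^+ k * c <= Num.sqrt (sqnorm x 1) * (K * k.+1%:R * Num.sqrt b ^+ k).
  by apply: (le_trans H1); apply: ler_wpM2l; [exact: sqrtr_ge0|exact: HK].
rewrite -(ler_pM2r sb0).
have -> : c * Num.sqrt b ^+ k * Num.sqrt b ^+ k = b ^+ k * c.
  by rewrite -mulrA -exprMn -expr2 sqr_sqrtr ?(ltW b0)// mulrC.
by apply: (le_trans H2); rewrite !mulrA.
Qed.

(** With y = k ln b / 4 the claim is k + 1 <= (1 + 4 / ln b) e^y, which follows from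
    1 + y <= e^y. *)
Lemma decay_rate (k : nat) (c C : R) : 0 <= C ->
  c * Num.sqrt b ^+ k <= C * k.+1%:R ->
  c <= C * (1 + 4 / ln b) * b `^ (- (k%:R / 4)).
Proof.
move=> C0 H; have b2' := b2.
have b0 : 0 < b by lra.
have l0 : 0 < ln b by rewrite ln_gt0//; lra.
pose y := k%:R / 4 * ln b.
have sqrtE : Num.sqrt b ^+ k = expR y * expR y.
  rewrite -expRD -powR12_sqrt ?ltW// -powR_mulrn ?powR_ge0// -powRrM.
  rewrite /powR gt_eqF//; congr expR; rewrite /y; by field.
have rateE : b `^ (- (k%:R / 4)) = (expR y)^-1.
  by rewrite /powR gt_eqF// -expRN; congr expR; rewrite /y; ring.
have ey := expR_gt0 y.
have y0 : 0 <= y by rewrite /y !mulr_ge0// ltW.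
have kle : k.+1%:R <= (1 + 4 / ln b) * expR y.
  apply: (@le_trans _ _ ((1 + 4 / ln b) * (1 + y))); last first.
    by apply: ler_wpM2l; [rewrite addr_ge0// divr_ge0// ltW|exact: expR_ge1Dx].
  have -> : (1 + 4 / ln b) * (1 + y) = 1 + y + 4 / ln b + k%:R.
    by rewrite /y; field; rewrite gt_eqF.
  have : 0 <= 4 / ln b by rewrite divr_ge0// ltW.
  by rewrite -natr1; lra.
rewrite rateE ler_pdivlMr// -(ler_pM2r ey) -mulrA -sqrtE; apply: (le_trans H).
by rewrite -!mulrA; apply: ler_wpM2l.
Qed.

End Families.

Unset Implicit Arguments.

Theorem mainTheorem2 (R : realType) (d : nat) (hd : (2 < d)%N)
  (V : choiceType) (E : rel V) (hT : regular_tree E d)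
  (A : finType) (a0 : A)
  (psi : V -> (V -> A) -> R)
  (psi_local : local E psi) (psi_sym : symmetric_family E psi)
  (r : nat) (hr : (0 < r)%N) (psi_range : has_range E r psi)
  (nu : probability (borel_config V a0) R)
  (hnu : unique_gibbs E psi r nu)
  (alpha : V -> (V -> A) -> R)
  (alpha_local : local E alpha) (alpha_sym : symmetric_family E alpha) :
  exists C : R, forall u v : V,
    (Cov nu (alpha u) (alpha v)
       <= (C * (d%:R - 1) `^ (- ((gdist E u v)%:R / 4)))%:E)%E.
Proof.
have oa := local_observable hT alpha_local alpha_sym.
have [C C0 HC] := cov_sqrt_decay hT hd psi_range psi_sym hnu oa.
exists (C * (1 + 4 / ln (d%:R - 1))) => u v.
have bu := observable_bounded a0 u oa; have bv := observable_bounded a0 v oa.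
rewrite /Cov (expectationE nu (bounded_measurableM bu bv)).
rewrite (expectationE nu bu) (expectationE nu bv) -EFinM -EFinB lee_fin.
exact: (decay_rate hd C0 (HC u v)).
Qed.
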